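(* In the setting described in the context, suppose the step sizes $a^{[n]}$, the errors $e^{[n]}$ and the observation frequencies $f^{[n]} = 1/(t^{[n]}-t^{[n-1]})$ ($n\ge 1$) satisfy $$\sum_{n=1}^\infty a^{[n]} = \infty,\qquad \sum_{n=1}^\infty (a^{[n]})^2 < \infty,\qquad \sum_{n=1}^\infty a^{[n]} e^{[n]} < \infty,$$ and, for every $\kappa \in (0,\infty)$, $$\sum_{n=1}^\infty a^{[n]} \exp\Bigl( - \frac{(e^{[n]})^2}{4 |\Omega|^2 \kappa f^{[n]}} \Bigr) < \infty .$$ Suppose moreover that there exist constants $c_{\mathrm g}, c_{\mathrm l} \in [0,\infty)$ such that for all probability vectors $\mu,\nu$ on $\Omega$ and all $r \in \mathcal R$, $$|g_i(\mu,r) - g_i(\nu,r)| \le c_{\mathrm l} \,\|\mu-\nu\|_{\mathrm{var}} \quad (i=1,\dots,d), \qquad \|g(\mu,r)\|_2 \le c_{\mathrm g}.$$ Then the sequence $R^{[n]}$ generated by the online algorithm $$R^{[n+1]} = \bigl[ R^{[n]} - a^{[n+1]} \hat G^{[n+1]} \bigr]^{\mathcal R}$$ converges, with probability one, to the optimal solution $r^{\mathrm{opt}}$ of $\min_{r\in\mathcal R} u(r)$.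
   Context: Optimization problem. $\Omega$ is a finite set and $d \ge 1$. $\mathcal R = [\mathcal R_1^{\min},\mathcal R_1^{\max}]\times\dots\times[\mathcal R_d^{\min},\mathcal R_d^{\max}] \subset \mathbb R^d$. For each parameter vector $r\in\mathcal R$ there is a continuous-time, irreducible, reversible Markov process $\{X(t)\}_{t\ge0}$ on $\Omega$, with generator depending on $r$ and stationary probability vector $\pi(r)$. The objective function $u$ is convex on $\mathcal R$, has a unique minimizer $r^{\mathrm{opt}} = \arg\min_{r\in\mathcal R} u(r)$, and its gradient can be written as $\nabla_r u(r) = g(\pi(r),r)$ for $r\in\mathcal R$, where $g$ is an $\mathbb R^d$-valued function of a probability vector on $\Omega$ and of $r\in\mathcal R$. Notation. $[r]^{\mathcal R}$ denotes the truncation defined componentwise by $([r]^{\mathcal R})_i = \max\{\mathcal R_i^{\min}, \min\{\mathcal R_i^{\max}, r_i\}\}$. $\|\mu-\nu\|_{\mathrm{var}} = \frac12\sum_{x\in\Omega}|\mu_x-\nu_x|$. Online algorithm. Deterministic times $0=t^{[0]}<t^{[1]}<\dots$, step sizes $a^{[n]}\in(0,\infty)$ and errors $e^{[n]}\in[0,1]$ ($n\ge1$) are given; the initial parameters satisfy $R^{[0]}\in\mathcal R$. The system is described by a process $\{Y(t)\}_{t\ge0}$ on $\Omega$ with $Y(t)=Z^{[n]}(t)$ for $t\in[t^{[n]},t^{[n+1]}]$, where $\{Z^{[n]}(t)\}_{t^{[n]}\le t\le t^{[n+1]}}$ is a time-homogeneous Markov process that starts in state $Z^{[n-1]}(t^{[n]})$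 (for $n=0$, in the initial state $X(0)$) and evolves according to the generator corresponding to the parameters $R^{[n]}$. At time $t^{[n+1]}$ one computes the empirical distribution $$\hat\Pi^{[n+1]}_x = \frac{1}{t^{[n+1]}-t^{[n]}}\int_{t^{[n]}}^{t^{[n+1]}} \mathbf 1[Z^{[n]}(t)=x]\,dt,\qquad x\in\Omega,$$ the gradient estimate $\hat G^{[n+1]} = g(\hat\Pi^{[n+1]},R^{[n]})$, and then the new parameters $R^{[n+1]}$ by the algorithm's recursion.
   Formalization: The formal theorem additionally assumes that each transition rate of the generator depends continuously on r in the box; without such uniformity the claim fails, e.g. for two states with both rates r^10 for r>0 and 1 at r=0. *)

(* Defs.v *)
From HB Require Import structures.
From mathcomp Require Import all_boot all_order all_algebra.
From mathcomp Require Import all_classical all_reals all_analysis.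

Set Implicit Arguments.
Unset Strict Implicit.
Unset Printing Implicit Defensive.

Import Order.TTheory GRing.Theory Num.Theory.
Import numFieldNormedType.Exports.

Local Open Scope classical_set_scope.
Local Open Scope ring_scope.

Section Vectors.
Context {R : realType} {d : nat}.
Implicit Types (r v lo hi : 'rV[R]_d).

Definition box lo hi : set 'rV[R]_d :=
  [set r | forall i, lo 0 i <= r 0 i <= hi 0 i].

Definition truncate lo hi r : 'rV[R]_d :=
  \row_i Num.max (lo 0 i) (Num.min (hi 0 i) (r 0 i)).

Definition dot v r : R := \sum_i v 0 i * r 0 i.

(* The library norm on matrices is the sup norm. *)
Definition norm2 v : R := Num.sqrt (\sum_i v 0 i ^+ 2).

(* [v] is a gradient at [r] of [u] as a function on [D]: only increments that
   stay in [D] are tested, so [u] is unconstrained outside [D] and the notion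
   makes sense on the boundary of [D]. *)
Definition gradient_within (D : set 'rV[R]_d) (u : 'rV[R]_d -> R) r v :=
  (u r' - u r - dot v (r' - r)) / norm2 (r' - r)
    @[r' --> within D r^'] --> (0 : R).

Definition unique_minimizer (D : set 'rV[R]_d) (u : 'rV[R]_d -> R) r :=
  [/\ D r, forall r', D r' -> u r <= u r'
    & forall r', D r' -> (forall r'', D r'' -> u r' <= u r'') -> r' = r].

End Vectors.

Section Chains.
Context {R : realType} {Omega : finType}.
Implicit Types (mu nu pi : Omega -> R) (q : Omega -> Omega -> R).

Definition prob_vector mu := (forall x, 0 <= mu x) /\ \sum_x mu x = 1.

Definition var_dist mu nu : R := 2^-1 * \sum_x `|mu x - nu x|.

Definition generator q :=
  (forall x y, x != y -> 0 <= q x y) /\ (forall x, \sum_y q x y = 0).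

Definition irreducible_chain q :=
  forall x y, connect (fun x' y' => 0 < q x' y') x y.

Definition stationary q pi :=
  prob_vector pi /\ forall y, \sum_x pi x * q x y = 0.

Definition reversible q pi := forall x y, pi x * q x y = pi y * q y x.

Definition generator_mx q : 'M[R]_#|Omega| :=
  \matrix_(i, j) q (enum_val i) (enum_val j).

(* The transition function exp(t q), as an entrywise exponential series. *)
Definition transition q (t : R) (x y : Omega) : R :=
  limn (series (fun k =>
    t ^+ k / k`!%:R * (generator_mx q ^+ k) (enum_rank x) (enum_rank y))).

End Chains.

Section Processes.
Context {R : realType} {Omega : finType} {d : measure_display}
  {T : measurableType d}.
Implicit Types (F : R -> set (set T)) (Y : R -> T -> Omega).

(* Time is [0, +oo[ ; values at negative times are irrelevant. *)
Definition filtration F :=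
  [/\ forall t, 0 <= t -> sigma_algebra setT (F t),
      forall t, 0 <= t -> F t `<=` measurable
    & forall s t, 0 <= s -> s <= t -> F s `<=` F t].

Definition adapted F Y :=
  forall t x, 0 <= t -> F t [set w | Y t w = x].

(* Right-continuity for the discrete topology on Omega. *)
Definition right_cont_paths Y :=
  forall w t, 0 <= t -> exists2 eps : R, 0 < eps &
    forall s, t <= s -> s < t + eps -> Y s w = Y t w.

(* On the time interval [a, b], Y is a time-homogeneous Markov process with
   respect to F with the random generator q, which is meant to be known at
   time a:  P(Y_t = y | F_s) = exp((t - s) q)(Y_s, y)  for a <= s <= t <= b. *)
Definition markov_on (P : probability T R) F Y (a b : R)
    (q : T -> Omega -> Omega -> R) :=
  forall (s t : R) (x y : Omega) (A : set T),
    a <= s -> s <= t -> t <= b -> F s A ->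
    P (A `&` [set w | Y s w = x] `&` [set w | Y t w = y]) =
    (\int[P]_(w in A `&` [set w | Y s w = x])
      (transition (q w) (t - s) x y)%:E)%E.

(* Fraction of the time interval [a, b] spent in x. *)
Definition empirical Y (a b : R) (w : T) (x : Omega) : R :=
  (b - a)^-1 * \int[lebesgue_measure]_(t in `[a, b]) (Y t w == x)%:R.

End Processes.

Definition obs_freq {R : realType} (tau : nat -> R) (n : nat) : R :=
  (tau n - tau n.-1)^-1.

(* Main.v *)
Require Import Defs.
From HB Require Import structures.
From mathcomp Require Import all_boot all_order all_algebra.
From mathcomp Require Import all_classical all_reals all_analysis.
From mathcomp Require Import measurable_realfun ring lra.

Set Implicit Arguments.
Unset Strict Implicit.
Unset Printing Implicit Defensive.

Import Order.TTheory GRing.Theory Num.Theory.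
Import numFieldNormedType.Exports.

Local Open Scope classical_set_scope.
Local Open Scope ring_scope.

(** The iterates follow projected gradient descent for the convex function [u],
    except that [g] is evaluated at an empirical distribution instead of the
    stationary one.  If these perturbations are summable against the step
    sizes, the squared distance to [ropt] decreases at every step by
    [2 a (u r - u ropt)] up to summable terms; as the step sizes are not
    summable, [u r] cannot stay away from its minimum, and convergence follows
    by compactness ([projected_gradient_cvg]).

    Since [g] is Lipschitz in its first argument, it remains to see that almost
    surely the sum over [n] of [a n.+1] times the distance between the
    [n]-th empirical distribution and [pi (Rn n)] is finite, and this follows
    from the convergence of the series of expectations
    ([ae_bounded_partial_sums]).

    The expectations are controlled through second moments.  The generator plus
    the all-ones matrix is invertible, and column [x] of the inverse is a
    function [h] with [q h = 1_x - pi x] ([poisson_eq]); it depends continuously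
    on the parameter, so it is bounded uniformly over the compact box.  Along a
    subdivision of an interval of length [D], the Poisson equation turns the
    excess time spent in [x] into boundary values of [h] plus a sum of
    martingale differences, each with variance of the order of the mesh; its
    second moment is therefore of order [D] ([additive_functional_var]).
    Refining the subdivision, the mean square of the error of the empirical
    frequency is at most [C / D] ([empirical_mean_square]).

    This matches the summability hypotheses, with [kappa = 1]: when
    [e ^ 2 D >= 1] the mean error is at most a constant times [e], and when
    [e ^ 2 D < 1] the exponential weight is bounded below, so that the trivial
    bound [1] is at most a constant times that weight ([empirical_mean_abs]). *)

(** * Projected gradient steps with summable errors *)

(** [D] minus the partial sums of [s] is nonincreasing and bounded below. *)
Lemma quasi_supermartingale_seq (R : realType) (D b s : nat -> R) (M : R) :
  (forall n, 0 <= D n) -> (forall n, 0 <= b n) -> (forall n, 0 <= s n) ->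
  (forall n, D n.+1 <= D n - b n + s n) ->
  (forall n, \sum_(i < n) s i <= M) ->
  cvgn D /\ forall n, \sum_(i < n) b i <= D 0%N + M.
Proof.
move=> D0 b0 s0 DS sM; split.
  pose S n := \sum_(i < n) s i.
  have cS : cvgn S.
    apply: nondecreasing_is_cvgn.
      by apply/nondecreasing_seqP => n; rewrite /S big_ord_recr /= lerDl.
    by exists M => _ [n _ <-]; exact: sM.
  have cE : cvgn (D \- S).
    apply: nonincreasing_is_cvgn.
      apply/nonincreasing_seqP => n; rewrite /= /S big_ord_recr /=.
      have := DS n; have := b0 n; lra.
    exists (- M) => _ [n _ <-] /=; have := D0 n; have := sM n; rewrite -/(S n); lra.
  have -> : D = (D \- S) \+ S by apply/funext => n /=; rewrite subrK.
  exact: is_cvgD.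
move=> n.
suff H : D n + \sum_(i < n) b i <= D 0%N + \sum_(i < n) s i.
  by have := D0 n; have := sM n; lra.
elim: n => [|n IH]; first by rewrite !big_ord0.
by rewrite !big_ord_recr /=; have := DS n; lra.
Qed.

Section Truncation.
Context {R : realType} {d : nat}.
Implicit Types (lo hi r z v : 'rV[R]_d).

Lemma truncate_box lo hi r :
  (forall i, lo 0 i <= hi 0 i) -> box lo hi (truncate lo hi r).
Proof. by move=> lohi i; rewrite mxE le_max lexx /= ge_max lohi ge_min lexx. Qed.

Lemma truncate_contract lo hi r z i : box lo hi z ->
  `|truncate lo hi r 0 i - z 0 i| <= `|r 0 i - z 0 i|.
Proof.
move=> /(_ i) /andP[lz zh]; rewrite mxE /Num.max /Num.min.
have := ler_norm (r 0 i - z 0 i); have := ler_norm (- (r 0 i - z 0 i)).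
rewrite normrN ler_norml; move: lz zh.
by case: (ltP (hi 0 i)) => ?; case: ltP => ?; lra.
Qed.

Lemma box_compact lo hi : compact (box lo hi).
Proof.
have -> : box lo hi = [set v | forall i, `[lo 0 i, hi 0 i]%classic (v ord0 i)].
  by apply/seteqP; split => v /= vb i; have := vb i; rewrite in_itv.
apply: (@rV_compact R d (fun i => `[lo 0 i, hi 0 i]%classic)) => i.
exact: segment_compact.
Qed.

Lemma dotZ (c : R) v z : dot v (c *: z) = c * dot v z.
Proof. by rewrite /dot mulr_sumr; apply: eq_bigr => i _; rewrite mxE mulrCA. Qed.

Lemma norm2Z (c : R) v : 0 <= c -> norm2 (c *: v) = c * norm2 v.
Proof.
move=> c0; rewrite /norm2.
under eq_bigr do rewrite mxE exprMn.
by rewrite -mulr_sumr sqrtrM ?sqr_ge0 // sqrtr_sqr ger0_norm.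
Qed.

Lemma norm2_gt0 v : v != 0 -> 0 < norm2 v.
Proof.
move=> v0; rewrite sqrtr_gt0 lt_neqAle sumr_ge0 ?andbT; last first.
  by move=> i _; exact: sqr_ge0.
apply: contra v0; rewrite eq_sym => /eqP v0.
apply/eqP/rowP => i; rewrite mxE; apply/eqP.
rewrite -sqrf_eq0; apply/eqP.
by have /psumr_eq0P := v0; apply => // j _; exact: sqr_ge0.
Qed.

Lemma norm2_ge_coord v i : `|v 0 i| <= norm2 v.
Proof.
rewrite -sqrtr_sqr ler_wsqrtr // (bigD1 i) //= lerDl sumr_ge0 // => j _.
exact: sqr_ge0.
Qed.

Lemma norm2_le_norm v : norm2 v <= d%:R * `|v|.
Proof.
have vn i : `|v 0 i| <= `|v|.
  by rewrite [leRHS]mx_normrE (le_bigmax _ (fun ij => `|v ij.1 ij.2|) (0, i)).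
rewrite -[leRHS]ger0_norm ?mulr_ge0 // -sqrtr_sqr ler_wsqrtr //.
apply: (@le_trans _ _ (\sum_(i < d) `|v| ^+ 2)).
  by apply: ler_sum => i _; rewrite -real_normK ?num_real // lerXn2r ?nnegrE.
rewrite sumr_const card_ord -[leLHS]mulr_natl exprMn ler_wpM2r ?sqr_ge0 //.
by rewrite -natrX ler_nat; case: (d) => // n; rewrite expnS expn1 leq_pmulr.
Qed.

(** The difference quotient in [gradient_within] is only controlled away from
    the base point; multiplying by the norm removes the exception. *)
Lemma gradient_withinP (D : set 'rV[R]_d) (u : 'rV[R]_d -> R) r v :
  gradient_within D u r v -> forall eps, 0 < eps ->
  \forall r' \near r, D r' -> `|u r' - u r - dot v (r' - r)| <= eps * norm2 (r' - r).
Proof.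
move=> /cvgrPdist_lt grad eps eps0.
have := grad _ eps0; rewrite !near_withinE.
apply: filterS => r' H Dr'.
have [->|r'r] := eqVneq r' r.
  by rewrite !subrr -(scale0r (0 : 'rV_d)) dotZ mul0r subr0 normr0 norm2Z // mul0r mulr0.
have np : 0 < norm2 (r' - r) by rewrite norm2_gt0 ?subr_eq0.
have := H r'r Dr'.
by rewrite sub0r normrN normrM normfV (gtr0_norm np) ltr_pdivrMr // => /ltW.
Qed.

Lemma gradient_within_continuous (D : set 'rV[R]_d) (u : 'rV[R]_d -> R)
    (G : 'rV[R]_d -> 'rV[R]_d) :
  (forall r, D r -> gradient_within D u r (G r)) -> {within D, continuous u}.
Proof.
move=> grad; apply/subspace_continuousP => r Dr.
apply/cvgrPdist_le => eps eps0; rewrite near_withinE.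
have := gradient_withinP (grad r Dr) ltr01.
pose K := d%:R * (1 + \sum_i `|G r 0 i|) : R.
have K0 : 0 <= K by rewrite mulr_ge0 // addr_ge0 // sumr_ge0.
have eK : 0 < eps / (K + 1) by rewrite divr_gt0 // ltr_wpDl.
have /cvgrPdist_lt /(_ _ eK) := @cvg_id _ (nbhs r).
apply: filterS2 => r' rr' H Dr'.
have dotle : `|dot (G r) (r' - r)| <= (\sum_i `|G r 0 i|) * norm2 (r' - r).
  rewrite mulr_suml; apply: le_trans (ler_norm_sum _ _ _) _.
  by apply: ler_sum => i _; rewrite normrM ler_wpM2l // norm2_ge_coord.
have n2 := norm2_le_norm (r' - r).
rewrite distrC -(subrK (dot (G r) (r' - r)) (u r' - u r)).
apply: le_trans (ler_normD _ _) _.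
apply: le_trans (lerD (H Dr') dotle) _; rewrite -mulrDl.
apply: (@le_trans _ _ (K * `|r' - r|)).
  by rewrite /K (mulrC d%:R) -mulrA ler_wpM2l // addr_ge0 // sumr_ge0.
rewrite distrC; apply: (@le_trans _ _ ((K + 1) * (eps / (K + 1)))).
  by apply: ler_pM => //; [rewrite lerDl | exact: ltW].
by rewrite mulrC divfK // gt_eqF // ltr_wpDl.
Qed.

(** Compare the chord bound of convexity with the first-order expansion at a
    point of the segment from [r] to [z] close to [r]. *)
Lemma convex_above_tangent (D : set 'rV[R]_d) (u : 'rV[R]_d -> R) r z v :
  @convex_function R 'rV[R]_d D u -> D r -> D z ->
  (forall s, 0 <= s <= 1 -> D (r + s *: (z - r))) ->
  gradient_within D u r v -> dot v (z - r) <= u z - u r.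
Proof.
move=> ucv Dr Dz Dseg grad.
have lin eps : 0 < eps -> dot v (z - r) <= u z - u r + eps * norm2 (z - r).
  move=> eps0.
  have /nbhs_ballP[del /= del0 Hdel] := gradient_withinP grad eps0.
  (* small enough for [r + s (z - r)] to be within [del] of [r] *)
  pose s := Num.min 1 (del / 2 / (`|z - r| + 1)).
  have N0 : 0 < `|z - r| + 1 by rewrite ltr_wpDl.
  have s0 : 0 < s by rewrite lt_min ltr01 /= !divr_gt0.
  have s1 : s <= 1 by rewrite ge_min lexx.
  have s01 : 0 <= s <= 1 by rewrite ltW.
  have Drs := Dseg s s01.
  have := Hdel (r + s *: (z - r)).
  rewrite /= -ball_normE /= opprD addNKr normrN normrZ gtr0_norm //.
  have sl : s * `|z - r| < del.
    apply: (@le_lt_trans _ _ (del / 2)); last by rewrite ltr_pdivrMr // ltr_pMr // ltr1n.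
    apply: (@le_trans _ _ (s * (`|z - r| + 1))); first by rewrite ler_wpM2l ?lerDl ?(ltW s0).
    by rewrite -ler_pdivlMr // ge_min lexx orbT.
  move=> /(_ sl Drs); rewrite [_ + _ - r]addrAC subrr add0r dotZ norm2Z ?(ltW s0) //.
  move=> /ler_normlP[tang _].
  have cv : u (r + s *: (z - r)) <= s * u z + (1 - s) * u r.
    have i01 : Itv.spec (@Itv.num_sem R) (Itv.Real `[0%Z, 1%Z]) s.
      by rewrite /Itv.spec /Itv.num_sem /= num_real /= in_itv /= s01.
    have := ucv (Itv.mk i01) z r (mem_set Dz) (mem_set Dr).
    rewrite convRE /=; apply: le_trans; rewrite le_eqVlt; apply/orP; left; apply/eqP.
    congr (u _); rewrite /conv /= /unstable.onem.
    by rewrite scalerBr scalerBl scale1r addrCA addrA.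
  have : s * dot v (z - r) <= s * (u z - u r + eps * norm2 (z - r)) by lra.
  by rewrite ler_pM2l.
apply/ler_addgt0Pr => eps eps0.
have nn : 0 <= norm2 (z - r) by exact: sqrtr_ge0.
have e1 : 0 < eps / (norm2 (z - r) + 1) by rewrite divr_gt0 // ltr_wpDl.
apply: le_trans (lin _ e1) _; rewrite lerD2l.
by rewrite mulrAC ler_pdivrMr ?ltr_wpDl // ler_wpM2l ?lerDl ?ltW.
Qed.
End Truncation.

(** The squared distance to the minimiser drops by
    [2 a n (u (r n) - u ropt)] up to summable terms, so it converges and the
    drops are summable; a positive limit would keep [r n] in a compact set on
    which [u - u ropt] is bounded below, contradicting the divergence of the
    step sizes. *)
Lemma projected_gradient_cvg (R : realType) (d : nat) (lo hi : 'rV[R]_d)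
    (u : 'rV[R]_d -> R) (ropt : 'rV[R]_d) (G : 'rV[R]_d -> 'rV[R]_d)
    (r ghat : nat -> 'rV[R]_d) (a z : nat -> R) (cg A B : R) :
  @convex_function R 'rV[R]_d (box lo hi) u ->
  unique_minimizer (box lo hi) u ropt ->
  (forall x, box lo hi x -> gradient_within (box lo hi) u x (G x)) ->
  box lo hi (r 0%N) ->
  (forall n, r n.+1 = truncate lo hi (r n - a n *: ghat n)) ->
  (forall n, 0 < a n) ->
  (forall n, norm2 (ghat n) <= cg) ->
  (forall n, 0 <= z n) ->
  (forall n i, `|ghat n 0 i - G (r n) 0 i| <= z n) ->
  (forall M, exists n, M < \sum_(i < n) a i) ->
  (forall n, \sum_(i < n) a i ^+ 2 <= A) ->
  (forall n, \sum_(i < n) a i * z i <= B) ->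
  r n @[n --> \oo] --> ropt.
Proof.
move=> ucv [optb umin uniq] grad r0 rS a0 gh z0 gerr adiv asq aerr.
have lohi i : lo 0 i <= hi 0 i by have /andP[h1 h2] := optb i; exact: le_trans h2.
have rb n : box lo hi (r n) by case: n => // n; rewrite rS; exact: truncate_box.
pose dist2 (x : 'rV[R]_d) := \sum_i (x 0 i - ropt 0 i) ^+ 2.
pose W := \sum_i (hi 0 i - lo 0 i).
have W0 : 0 <= W by apply: sumr_ge0 => i _; rewrite subr_ge0.
have zW n : 0 <= z n * W by rewrite mulr_ge0.
have drop n : dot (ghat n) (ropt - r n) <= u ropt - u (r n) + z n * W.
  have tang : dot (G (r n)) (ropt - r n) <= u ropt - u (r n).
    apply: (convex_above_tangent ucv) => //; last exact: grad.
    move=> s /andP[s0 s1] i; rewrite !mxE.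
    have /andP[? ?] := rb n i; have /andP[? ?] := optb i; apply/andP; split; nra.
  have -> : dot (ghat n) (ropt - r n) =
      dot (G (r n)) (ropt - r n) + dot (ghat n - G (r n)) (ropt - r n).
    rewrite /dot -big_split /=; apply: eq_bigr => i _.
    by rewrite !mxE; ring.
  apply: lerD => //; rewrite /dot mulr_sumr; apply: ler_sum => i _.
  apply: le_trans (ler_norm _) _; rewrite normrM !mxE ler_pM //.
  have /andP[? ?] := rb n i; have /andP[? ?] := optb i.
  by rewrite ler_norml; lra.
have step n : dist2 (r n.+1) <=
    dist2 (r n) - 2 * a n * (u (r n) - u ropt) + (2 * W * (a n * z n) + cg ^+ 2 * a n ^+ 2).
  apply: (@le_trans _ _ (\sum_i ((r n - a n *: ghat n) 0 i - ropt 0 i) ^+ 2)).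
    apply: ler_sum => i _; rewrite rS -[leLHS]real_normK ?num_real //.
    by rewrite -[leRHS]real_normK ?num_real // lerXn2r ?nnegrE // truncate_contract.
  have -> : \sum_i ((r n - a n *: ghat n) 0 i - ropt 0 i) ^+ 2 =
      dist2 (r n) + 2 * a n * dot (ghat n) (ropt - r n) + a n ^+ 2 * \sum_i ghat n 0 i ^+ 2.
    rewrite /dist2 /dot !mulr_sumr -!big_split /=; apply: eq_bigr => i _.
    by rewrite !mxE; ring.
  have g2 : \sum_i ghat n 0 i ^+ 2 <= cg ^+ 2.
    rewrite -[leLHS]sqr_sqrtr ?sumr_ge0 // => [|i _]; last exact: sqr_ge0.
    by rewrite lerXn2r ?nnegrE ?sqrtr_ge0 ?gh // (le_trans _ (gh n)) ?sqrtr_ge0.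
  have := drop n; have := a0 n; have := sqr_ge0 (a n); nra.
have ugap n : 0 <= u (r n) - u ropt by rewrite subr_ge0 umin.
have [cD sumb] : cvgn (fun n => dist2 (r n)) /\ forall n,
    \sum_(i < n) 2 * a i * (u (r i) - u ropt) <= dist2 (r 0%N) + (2 * W * B + cg ^+ 2 * A).
  apply: (quasi_supermartingale_seq _ _ _ step).
  - by move=> n; apply: sumr_ge0 => i _; exact: sqr_ge0.
  - by move=> n; rewrite mulr_ge0 // mulr_ge0 // ltW.
  - move=> n; rewrite addr_ge0 // mulr_ge0 ?sqr_ge0 // ?mulr_ge0 //; exact: ltW.
  - move=> n; rewrite big_split /= -!mulr_sumr.
    by apply: lerD; apply: ler_wpM2l; rewrite ?sqr_ge0 ?asq ?aerr // mulr_ge0.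
have L0 : limn (fun n => dist2 (r n)) = 0.
  set L := limn _; apply/eqP; rewrite eq_le; apply/andP; split; last first.
    apply: limr_ge; [exact: cD|apply: nearW => n].
    by apply: sumr_ge0 => i _; exact: sqr_ge0.
  rewrite leNgt; apply/negP => Lpos.
  have far : \forall n \near \oo, L / 2 <= dist2 (r n).
    have L2 : L / 2 < L by lra.
    have /cvgrPdist_lt /(_ (L / 2)) := cD.
    rewrite divr_gt0 // => /(_ isT); apply: filterS => n; rewrite -/L ltr_norml; lra.
  have dist2_cont : continuous dist2.
    apply: continuous_big => [|i _ x]; first exact: add_continuous.
    apply: (@cvgM R _ (nbhs x) _ (fun x : 'rV[R]_d => x 0 i - ropt 0 i)); apply: cvgB;
      by [exact: coord_continuous|exact: cvg_cst].
  pose K := box lo hi `&` dist2 @^-1` [set x | L / 2 <= x].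
  have cK : compact K.
    apply: compact_closedI; first exact: box_compact.
    by apply: closed_comp => [x _|]; [exact: dist2_cont|exact: closed_ge].
  case: far => N _ far.
  have K0 : K !=set0 by exists (r N); split => //; exact: far (leqnn N).
  have uK : {within K, continuous u}.
    apply: (@continuous_subspaceW _ _ _ (box lo hi)); first by move=> ? [].
    exact: gradient_within_continuous grad.
  have [c] := compact_EVT_min K0 cK uK; rewrite inE => -[cb cfar] cmin.
  pose eta := u c - u ropt.
  have eta0 : 0 < eta.
    rewrite subr_gt0 lt_neqAle umin // andbT; apply/eqP => uc.
    have cr : c = ropt by apply: uniq => // x xb; rewrite -uc umin.
    move: cfar; rewrite /= cr /dist2 big1 => [|i _]; first lra.
    by rewrite subrr expr0n.
  have := adiv (\sum_(i < N) a i + (dist2 (r 0%N) + (2 * W * B + cg ^+ 2 * A)) / (2 * eta)).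
  move=> [n]; rewrite ltNge => /negP; apply.
  have grow m : 2 * eta * (\sum_(i < N + m) a i - \sum_(i < N) a i) <=
      \sum_(i < N + m) 2 * a i * (u (r i) - u ropt).
    elim: m => [|m IH].
      by rewrite addn0 subrr mulr0 sumr_ge0 // => i _; rewrite mulr_ge0 // mulr_ge0 // ltW.
    rewrite addnS !big_ord_recr /=.
    have : eta <= u (r (N + m)%N) - u ropt.
      rewrite lerD2r cmin // inE; split => //; apply: far; exact: leq_addr.
    have := a0 (N + m)%N; nra.
  have mono : \sum_(i < n) a i <= \sum_(i < N + n) a i.
    by rewrite addnC big_split_ord /= lerDl sumr_ge0 // => i _; rewrite ltW.
  rewrite -lerBlDl ler_pdivlMr; last lra.
  by have := grow n; have := sumb (N + n)%N; nra.
apply/cvg_ballP => eps eps0.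
have /cvgrPdist_lt /(_ (eps ^+ 2)) := cD; rewrite exprn_gt0 // => /(_ isT).
rewrite L0; apply: filterS => n; rewrite sub0r normrN ltr_norml => /andP[_ Dn].
split => // i j; rewrite /ball /= ord1 distrC -ltr_sqr ?nnegrE ?(ltW eps0) //.
rewrite real_normK ?num_real //; apply: le_lt_trans Dn.
by rewrite /dist2 (bigD1 j) //= lerDl sumr_ge0 // => k _; exact: sqr_ge0.
Qed.

(** * Finite-state generators *)

Section Generators.
Context {R : realType} {Omega : finType}.
Implicit Types (q : Omega -> Omega -> R) (p h : Omega -> R).

Lemma sum_enum_val (F : Omega -> R) : \sum_(i < #|Omega|) F (enum_val i) = \sum_x F x.
Proof.
rewrite (reindex (@enum_val Omega Omega)) //=.
exact: onW_bij (enum_val_bij Omega).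
Qed.

(** Maximum principle: where [h] is maximal, harmonicity forces its neighbours
    to be maximal as well, and the chain connects all states. *)
Lemma harmonic_constant q h : generator q -> irreducible_chain q ->
  (forall x, \sum_y q x y * h y = 0) -> forall x y, h x = h y.
Proof.
move=> [qpos qsum] irr harm x y.
pose m := [arg max_(z > x) h z]%O.
have hm z : h z <= h m.
  by rewrite /m; case: arg_maxP => // i _; apply.
suff E s : h s = h m by rewrite !E.
have /connectP[p + ->] := irr m s.
have : h m = h m by [].
move: {1 3 4}m; elim: p => [|w p IH] v hv //= /andP[qvw pw].
apply: IH => //.
have zero : \sum_(z | z != v) q v z * (h m - h z) = 0.
  have : \sum_z q v z * (h m - h z) = 0.
    under eq_bigr do rewrite mulrBr.
    by rewrite sumrB -mulr_suml qsum mul0r harm subr0.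
  by rewrite (bigD1 v) //= hv subrr mulr0 add0r.
have [->//|wv] := eqVneq w v.
have /psumr_eq0P : forall z, z != v -> 0 <= q v z * (h m - h z).
  by move=> z zv; rewrite mulr_ge0 ?subr_ge0 // qpos // eq_sym.
move=> /(_ zero w wv) /eqP; rewrite mulf_eq0 gt_eqF //= subr_eq0 => /eqP.
by move=> ->.
Qed.

(** The generator is singular, constants being its kernel; adding the all-ones
    matrix makes it invertible, and the columns of the inverse solve the
    Poisson equations for the indicators of states. *)
Definition poisson_mx q : 'M[R]_#|Omega| :=
  invmx (generator_mx q + const_mx 1).

Definition poisson q (x y : Omega) : R :=
  poisson_mx q (enum_rank x) (enum_rank y).

(** If [q h] plus the sum of [h] vanishes, averaging against the stationary
    distribution kills [q h]; so the sum is zero, [h] is harmonic, hence constant,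
    hence zero. *)
Lemma perturbed_generator_unit q p : generator q -> irreducible_chain q ->
  stationary q p -> generator_mx q + const_mx 1 \in unitmx.
Proof.
move=> gq irr [[p0 p1] pq].
rewrite -unitmx_tr -row_free_unit -kermx_eq0; apply/eqP/row_matrixP => i.
rewrite row0; set v := row i _.
have : v *m (generator_mx q + const_mx 1)^T = 0.
  by apply/sub_kermxP; exact: row_sub.
move: v => v.
move=> /(congr1 trmx); rewrite trmx_mul trmxK trmx0 => /matrixP ker.
pose h x := v 0 (enum_rank x); pose S := \sum_x h x.
have eqn s : \sum_y q s y * h y + S = 0.
  have := ker (enum_rank s) 0; rewrite mxE [RHS]mxE => K; rewrite -[RHS]K.
  rewrite /S -big_split -sum_enum_val; apply: eq_bigr => j _ /=.
  by rewrite !mxE enum_rankK /h enum_valK mulrDl mul1r.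
have S0 : S = 0.
  have : \sum_x p x * (\sum_y q x y * h y + S) = 0.
    by apply: big1 => w _; rewrite eqn mulr0.
  under eq_bigr do rewrite mulrDr.
  rewrite big_split /= -mulr_suml p1 mul1r => <-.
  rewrite [X in _ = X + _](_ : _ = 0) ?add0r //.
  under eq_bigr do rewrite mulr_sumr.
  rewrite exchange_big /= big1 // => y _.
  under eq_bigr do rewrite mulrA.
  by rewrite -mulr_suml pq mul0r.
have hc : forall x y, h x = h y.
  by apply: (harmonic_constant gq irr) => s; have := eqn s; rewrite S0 addr0.
apply/rowP => j; rewrite [RHS]mxE -(enum_valK j) -/(h (enum_val j)).
have : S = #|Omega|%:R * h (enum_val j).
  rewrite /S (eq_bigr (fun=> h (enum_val j))) => [|y _]; last exact: hc.
  by rewrite sumr_const mulr_natl.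
rewrite S0 => /esym/eqP; rewrite mulf_eq0 pnatr_eq0 => /orP[/eqP O0|/eqP //].
by have := ltn_ord j; move: (nat_of_ord j) => k; rewrite O0.
Qed.

(** Averaging the equation (q + J) h = 1_x against the stationary distribution
    identifies J h, the sum of the entries of [h], with [p x]. *)
Lemma poisson_eq q p : generator q -> irreducible_chain q -> stationary q p ->
  forall x, p x = \sum_z poisson q z x /\
    forall y, \sum_z q y z * poisson q z x = (y == x)%:R - p x.
Proof.
move=> gq irr sp x; have uM := perturbed_generator_unit gq irr sp.
case: sp => [[p0 p1] pq].
have eqn y : \sum_z q y z * poisson q z x + \sum_z poisson q z x = (y == x)%:R.
  have /matrixP/(_ (enum_rank y) (enum_rank x)) := mulmxV uM.
  rewrite [in RHS]mxE (inj_eq enum_rank_inj) => <-.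
  rewrite !mxE -big_split -sum_enum_val; apply: eq_bigr => j _ /=.
  by rewrite !mxE enum_rankK /poisson enum_valK mulrDl mul1r.
suff E : \sum_z poisson q z x = p x by split=> // y; rewrite -eqn E addrK.
have -> : p x = \sum_y p y * (y == x)%:R.
  rewrite (bigD1 x) //= eqxx mulr1 big1 ?addr0 // => y /negbTE ->.
  by rewrite mulr0.
under [RHS]eq_bigr do rewrite -eqn mulrDr.
rewrite big_split /= -mulr_suml p1 mul1r.
rewrite [X in _ = X + _](_ : _ = 0) ?add0r //.
under eq_bigr do rewrite mulr_sumr.
rewrite exchange_big /= big1 // => z _.
under eq_bigr do rewrite mulrA.
by rewrite -mulr_suml pq mul0r.
Qed.

Lemma generator_mx_pow_le q c k i j : (forall x y, `|q x y| <= c) ->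
  `|(generator_mx q ^+ k) i j| <= (#|Omega|%:R * c) ^+ k.
Proof.
move=> qc; elim: k i j => [|k IH] i j.
  by rewrite !expr0 mxE; case: (i == j); rewrite ?normr1 ?normr0.
rewrite exprSr mxE; apply: le_trans (ler_norm_sum _ _ _) _.
apply: (@le_trans _ _ (\sum_(l < #|Omega|) (#|Omega|%:R * c) ^+ k * c)).
  by apply: ler_sum => l _; rewrite normrM ler_pM // mxE qc.
by rewrite sumr_const card_ord exprS -[leLHS]mulr_natl [_ ^+ k * c]mulrC mulrA.
Qed.

Definition transition_coef q (t : R) (x y : Omega) (k : nat) : R :=
  t ^+ k / k`!%:R * (generator_mx q ^+ k) (enum_rank x) (enum_rank y).

Lemma transition_coef_le q c t x y k : (forall x y, `|q x y| <= c) -> 0 <= t ->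
  `|transition_coef q t x y k| <= t ^+ k * exp_coeff (#|Omega|%:R * c) k.
Proof.
move=> qc t0; rewrite /transition_coef exp_coeffE !normrM normfV normr_nat.
rewrite ger0_norm ?exprn_ge0 // -mulrA ler_wpM2l ?exprn_ge0 //.
by rewrite ler_wpM2l ?invr_ge0 // generator_mx_pow_le.
Qed.

Lemma transition_cvg q c t x y : (forall x y, `|q x y| <= c) -> 0 <= t -> t <= 1 ->
  series (transition_coef q t x y) n @[n --> \oo] --> transition q t x y.
Proof.
move=> qc t0 t1; suff : cvgn (series (transition_coef q t x y)) by [].
apply: normed_cvg; apply: (@series_le_cvg _ _ (exp_coeff (#|Omega|%:R * c))).
- by move=> k; rewrite /= normr_ge0.
- move=> k; rewrite ?exp_coeff_ge0 // mulr_ge0 //; exact: le_trans (qc x y).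
- move=> k; apply: le_trans (transition_coef_le _ _ _ qc t0) _.
  rewrite ler_piMl ?exprn_ile1 // exp_coeff_ge0 // mulr_ge0 //.
  exact: le_trans (qc x y).
exact: is_cvg_series_exp_coeff.
Qed.

(** From the second term on, the exponential series is dominated by [t ^ 2]
    times the exponential series of a bound on the powers of the generator. *)
Lemma transition_expansion q c t x y : (forall x y, `|q x y| <= c) ->
  0 <= t -> t <= 1 ->
  `|transition q t x y - (x == y)%:R - t * q x y| <= expR (#|Omega|%:R * c) * t ^+ 2.
Proof.
move=> qc t0 t1; set C := _ * c.
have C0 : 0 <= C by rewrite mulr_ge0 //; exact: le_trans (qc x y).
have cv := transition_cvg (x := x) (y := y) qc t0 t1.
have cv' : series (transition_coef q t x y) n - (x == y)%:R - t * q x y @[n --> \oo]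
    --> transition q t x y - (x == y)%:R - t * q x y.
  by apply: cvgB; [apply: cvgB => //|]; exact: cvg_cst.
have /cvg_norm cv'' := cv'.
rewrite -(cvg_lim _ cv'') //; apply: limr_le; first by apply: cvgP cv''.
exists 2%N => // n /= n2; rewrite /series /=.
rewrite (big_cat_nat _ (n := 2)) //= big_nat_recr //= big_nat1.
rewrite {1 2}/transition_coef !expr0 expr1 fact0 divr1 mul1r mxE (inj_eq enum_rank_inj).
rewrite expr1 factS fact0 muln1 divr1 mxE !enum_rankK.
rewrite [X in `|X|](_ : _ = \sum_(2 <= k < n) transition_coef q t x y k); last by ring.
apply: le_trans (ler_norm_sum _ _ _) _.
apply: (@le_trans _ _ (t ^+ 2 * series (exp_coeff C) n)).
  rewrite /series /= mulr_sumr [leRHS](big_cat_nat _ (n := 2)) //=.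
  apply: (@le_trans _ _ (\sum_(2 <= k < n) t ^+ 2 * exp_coeff C k)).
        apply: ler_sum_nat => k /andP[k2 _].
    apply: le_trans (transition_coef_le _ _ _ qc t0) _.
    rewrite ler_wpM2r ?exp_coeff_ge0 // -(subnKC k2) exprD ler_piMr ?exprn_ge0 //.
    by rewrite exprn_ile1.
  by rewrite lerDr sumr_ge0 // => k _; rewrite mulr_ge0 ?exprn_ge0 ?exp_coeff_ge0.
rewrite mulrC ler_wpM2r ?exprn_ge0 //.
apply: nondecreasing_cvgn_le; last exact: is_cvg_series_exp_coeff.
by apply: nondecreasing_series => k *; rewrite exp_coeff_ge0.
Qed.

End Generators.

(** * Continuity, boundedness and measurability of the chain data *)

Lemma det_cvg (R : realType) (T : Type) (F : set_system T) (FF : Filter F) (n : nat)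
    (A : T -> 'M[R]_n) (A0 : 'M[R]_n) :
  (forall i j, A x i j @[x --> F] --> A0 i j) -> \det (A x) @[x --> F] --> \det A0.
Proof.
move=> cA; rewrite /determinant; apply: cvg_big => [|s _]; first exact: add_continuous.
apply: cvgM; first exact: cvg_cst.
by apply: cvg_big => [|i _]; [exact: mul_continuous|exact: cA].
Qed.

Lemma invmx_cvg (R : realType) (T : Type) (F : set_system T) (FF : Filter F) (n : nat)
    (A : T -> 'M[R]_n) (A0 : 'M[R]_n) i j :
  (\forall x \near F, A x \in unitmx) -> A0 \in unitmx ->
  (forall i j, A x i j @[x --> F] --> A0 i j) ->
  invmx (A x) i j @[x --> F] --> invmx A0 i j.
Proof.
move=> uA uA0 cA.
have E (M : 'M[R]_n) : M \in unitmx -> (\det M)^-1 * cofactor M j i = invmx M i j.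
  by move=> uM; rewrite /invmx uM !mxE.
rewrite -E //; apply: cvg_trans; first apply: (@near_eq_cvg _ _ _ _
    (fun x => (\det (A x))^-1 * cofactor (A x) j i)).
  by near=> x; apply/E; near: x.
apply: cvgM.
  by apply: cvgV; [rewrite -unitfE -unitmxE|exact: det_cvg].
apply: cvgM; first exact: cvg_cst.
by apply: det_cvg => k l; rewrite !mxE; under eq_fun do rewrite !mxE; exact: cA.
Unshelve. all: by end_near. Qed.

Lemma poisson_continuous (R : realType) (Omega : finType) (T : topologicalType)
    (D : set T) (Q : T -> Omega -> Omega -> R) (pi : T -> Omega -> R) :
  (forall r, D r -> generator (Q r)) ->
  (forall r, D r -> irreducible_chain (Q r)) ->
  (forall r, D r -> stationary (Q r) (pi r)) ->
  (forall x y, {within D, continuous (fun r => Q r x y)}) ->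
  forall x y, {within D, continuous (fun r => poisson (Q r) x y)}.
Proof.
move=> gQ irr st cQ x y; apply/subspace_continuousP => r Dr; rewrite /poisson.
have unit s : D s -> generator_mx (Q s) + const_mx 1 \in unitmx.
  by move=> Ds; apply: perturbed_generator_unit (st s Ds); [exact: gQ|exact: irr].
apply: invmx_cvg; [|exact: unit|].
  by rewrite near_withinE; apply: nearW => s; exact: unit.
move=> i j; rewrite !mxE; under eq_fun do rewrite !mxE.
apply: cvgD; last exact: cvg_cst.
by have /subspace_continuousP := cQ (enum_val i) (enum_val j); apply.
Qed.

(** The bound is uniform over the finite index set as well, which makes it
    applicable to all entries of a generator at once. *)
Lemma compact_within_bounded (R : realType) (I : finType) (T : topologicalType)
    (D : set T) (f : T -> I -> R) :
  compact D -> (forall i, {within D, continuous (f^~ i)}) ->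
  exists2 c, 0 <= c & forall r, D r -> forall i, `|f r i| <= c.
Proof.
move=> cD cf; have [D0|/nonemptyPn D0] := pselect (D !=set0); last first.
  by exists 0 => // r; rewrite D0.
have /choice [c cP] : forall i, exists c, forall r, D r -> `|f r i| <= c.
  move=> i; have cn : {within D, continuous (fun r => `|f r i|)}.
    by move=> r; apply: cvg_norm; exact: cf.
  have [m _ mP] := compact_EVT_max D0 cD cn.
  by exists `|f m i| => r Dr; apply: mP; rewrite inE.
have c0 i : 0 <= c i by case: D0 => r /(cP i); exact: le_trans.
exists (\sum_i c i); first exact: sumr_ge0.
move=> r Dr i; rewrite (bigD1 i) //= ler_wpDr ?cP //.
exact: sumr_ge0.
Qed.

(** Any preimage is a countable union of level sets of [m]. *)
Lemma measurable_fun_ffun_int d (T : measurableType d) (R : realType) (n : nat)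
    (m : T -> {ffun 'I_n -> int}) (phi : {ffun 'I_n -> int} -> R) :
  (forall i k, measurable [set w | m w i = k]) ->
  measurable_fun setT (fun w => phi (m w)).
Proof.
move=> mm _ B _; rewrite setTI.
have -> : (fun w => phi (m w)) @^-1` B =
    \bigcup_(s : {ffun 'I_n -> int}) ([set w | m w = s] `&` [set _ | B (phi s)]).
  apply/seteqP; split => [w /= Bw|w /= [s _ /= [<-]]] //.
  by exists (m w).
apply: countable_bigcupT_measurable => // s.
apply: measurableI; last first.
  by have [Bs|Bs] := pselect (B (phi s));
    [rewrite (_ : [set _ | _] = setT)|rewrite (_ : [set _ | _] = set0)] => //;
    apply/seteqP; split.
have -> : [set w | m w = s] = \bigcap_(i in [set: 'I_n]) [set w | m w i = s i].
  apply/seteqP; split => [w /= <- //|w ms]; apply/ffunP => i; exact: ms.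
exact: fin_bigcap_measurable.
Qed.

(** Rounding the coordinates of [Z] to a grid and truncating back to the box
    gives countably valued approximations, along which [phi] converges by
    continuity. *)
Lemma measurable_within_box d (T : measurableType d) (R : realType) (n : nat)
    (lo hi : 'rV[R]_n) (phi : 'rV[R]_n -> R) (Z : T -> 'rV[R]_n) :
  {within box lo hi, continuous phi} ->
  (forall w, box lo hi (Z w)) ->
  (forall i, measurable_fun setT (fun w => Z w 0 i)) ->
  measurable_fun setT (fun w => phi (Z w)).
Proof.
move=> cphi Zb mZ.
pose grid k (s : {ffun 'I_n -> int}) : 'rV[R]_n :=
  truncate lo hi (\row_i ((s i)%:~R / k.+1%:R)).
pose cell k w : {ffun 'I_n -> int} := [ffun i => Num.floor (k.+1%:R * Z w 0 i)].
apply: (@measurable_fun_cvg _ _ _ _ (fun k w => phi (grid k (cell k w)))).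
  move=> k; apply: (@measurable_fun_ffun_int _ _ _ _ (cell k) (fun s => phi (grid k s))) => i s.
  rewrite [X in measurable X](_ : _ =
      (fun w => k.+1%:R * Z w 0 i) @^-1` `[s%:~R, (s + 1)%:~R[%classic); last first.
    apply/seteqP; split => w /=; rewrite ffunE in_itv /= -floor_eq.
      by move=> ->.
    by move/eqP.
  rewrite -[X in measurable X]setTI; apply: measurable_funM => //.
move=> w _; have /subspace_continuousP /(_ _ (Zb w)) /cvgrPdist_lt cw := cphi.
apply/cvgrPdist_lt => eps /cw; rewrite near_withinE => /nbhs_ballP[del /= del0 H].
near=> k; apply: H; last first.
  by apply: truncate_box => i; have /andP[] := Zb w i; exact: le_trans.
split=> // i0 j; rewrite ord1 /ball /= distrC.
apply: le_lt_trans (truncate_contract _ _ (Zb w)) _.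
rewrite mxE ffunE distrC; have k0 : 0 < k.+1%:R :> R by [].
rewrite -(ltr_pM2l k0) -[X in X * `|_|]ger0_norm // -normrM mulrBr mulrCA divff // mulr1.
have /andP[f1 f2] := floor_itv (k.+1%:R * Z w 0 j).
rewrite ger0_norm ?subr_ge0 //; apply: (@lt_trans _ _ 1).
  by move: f2; rewrite intrD; lra.
rewrite mulrC -ltr_pdivrMr // mul1r.
near: k; exact: (near_infty_natSinv_lt (PosNum del0)).
Unshelve. all: by end_near. Qed.

Lemma measurable_transition d (T : measurableType d) (R : realType) (Omega : finType)
    (q : T -> Omega -> Omega -> R) (c t : R) :
  (forall w x y, `|q w x y| <= c) -> 0 <= t -> t <= 1 ->
  (forall x y, measurable_fun setT (fun w => q w x y)) ->
  forall x y, measurable_fun setT (fun w => transition (q w) t x y).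
Proof.
move=> qc t0 t1 mq x y.
apply: (@measurable_fun_cvg _ _ _ _
    (fun n w => series (transition_coef (q w) t x y) n)); last first.
  by move=> w _; exact: transition_cvg (qc w) t0 t1.
move=> n; rewrite /series /=; apply: measurable_sum => k.
apply: measurable_funM => //.
move: (enum_rank x) (enum_rank y) => i j {x y}.
elim: k i j => [|k IH] i j; first exact: measurable_cst.
under eq_fun do rewrite exprSr mxE.
apply: measurable_sum => l; apply: measurable_funM => //.
by under eq_fun do rewrite mxE; exact: mq.
Qed.

(** * Time averages as limits of Riemann sums *)

Definition right_locally_constant (R : realType) (V : Type) (a : R) (f : R -> V) :=
  forall t, a <= t -> exists2 eps, 0 < eps &
    forall s, t <= s -> s < t + eps -> f s = f t.

(** Evaluated at the right end points of a subdivision, the step functions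
    converge at every point, so dominated convergence applies.  The left end
    points, which are the ones adapted to the past, give the same sums up to
    the two extreme terms. *)
Lemma riemann_sum_cvg (R : realType) (f : R -> R) (a b M : R) :
  a < b -> (forall t, 0 <= f t <= M) -> right_locally_constant a f ->
  n.+1%:R^-1 * (\sum_(k < n.+1) f (a + k%:R * ((b - a) / n.+1%:R))) @[n --> \oo]
    --> (b - a)^-1 * \int[lebesgue_measure]_(t in `[a, b]) f t.
Proof.
move=> ab fM fr.
have ba : 0 < b - a by rewrite subr_gt0.
have M0 : 0 <= M by have /andP[h1 h2] := fM 0; exact: le_trans h2.
pose del n := (b - a) / n.+1%:R.
have del0 n : 0 < del n by rewrite divr_gt0.
pose g n k := a + k%:R * del n.
have g0 n : g n 0%N = a by rewrite /g mul0r addr0.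
have gS n k : g n k.+1 = g n k + del n by rewrite /g -natr1 mulrDl mul1r addrA.
have gN n : g n n.+1 = b by rewrite /g /del mulrC divfK // addrC subrK.
have gle n j k : (j <= k)%N -> g n j <= g n k.
  by move=> jk; rewrite lerD2l ler_pM2r // ler_nat.
have cellP n m t : a < t -> t <= g n m -> exists2 k, (k < m)%N & g n k < t <= g n k.+1.
  move=> at_; elim: m => [|m IH]; first by rewrite g0 => /(lt_le_trans at_); rewrite ltxx.
  move=> tm; have [/IH[k km kt]|gt] := leP t (g n m); first by exists k => //; exact: ltnW.
  by exists m => //; rewrite gt.
pose cell n k : set R := `]g n k, g n k.+1]%classic.
pose F n t := \sum_(k < n.+1) f (g n k.+1) * \1_(cell n k) t.
pose D : set R := `]a, b]%classic.
have FE n t k : (k < n.+1)%N -> g n k < t <= g n k.+1 -> F n t = f (g n k.+1).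
  move=> kn /andP[kt tk]; rewrite /F (bigD1 (Ordinal kn)) //= big1 => [|j jk].
    by rewrite addr0 indicE mem_set ?mulr1 // /cell /= in_itv /= kt tk.
  rewrite indicE memNset ?mulr0 // /cell /= in_itv /= => /andP[jt tj].
  move: jk; rewrite -val_eqE /= neq_ltn => /orP[jk|kj].
    by have := lt_le_trans kt (le_trans tj (gle n _ _ jk)); rewrite ltxx.
  by have := lt_le_trans jt (le_trans tk (gle n _ _ kj)); rewrite ltxx.
have inD n t : D t -> exists2 k, (k < n.+1)%N & g n k < t <= g n k.+1.
  by rewrite /D /= in_itv /= => /andP[at_ tb]; apply: cellP; rewrite ?gN.
have mF n : measurable_fun D (F n).
  apply: measurable_sum => k; apply: measurable_funM => //.
  apply: measurable_indic; exact: measurable_itv.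
have cF t : D t -> F n t @[n --> \oo] --> f t.
  move=> Dt; have at_ : a <= t by move: Dt; rewrite /D /= in_itv /= => /andP[/ltW].
  have [eps eps0 feps] := fr t at_.
  apply/cvgrPdist_lt => e e0; near=> n.
  have [k kn /[dup] kt /andP[k1 k2]] := inD n t Dt.
  rewrite (FE _ _ _ kn kt) feps ?subrr ?normr0 //.
  rewrite gS; apply: (@lt_le_trans _ _ (t + del n)); first by rewrite ltrD2r.
  rewrite lerD2l /del ler_pdivrMr // mulrC -ler_pdivrMr // ltW //.
  near: n; exists (Num.truncn ((b - a) / eps)) => // n /= Nn.
  apply: lt_le_trans (truncnS_gt _) _; by rewrite ler_nat ltnS.
have mf : measurable_fun D f by exact: measurable_fun_cvg mF cF.
have mD : measurable D by exact: measurable_itv.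
have muD : (lebesgue_measure D < +oo)%E.
  by rewrite /D lebesgue_measure_itv /=; case: ifP => _ //; rewrite -EFinB ltry.
have fi : lebesgue_measure.-integrable D (EFin \o f).
  apply: measurable_bounded_integrable => //.
  exists M; split; first exact: num_real.
  move=> x Mx y _; have /andP[h1 h2] := fM y.
  by rewrite /= ger0_norm // (le_trans h2) // ltW.
have FM n t : D t -> `|F n t| <= M.
  move=> /(inD n)[k kn kt]; rewrite (FE _ _ _ kn kt).
  by have /andP[h1 h2] := fM (g n k.+1); rewrite ger0_norm.
have intF n : (\int[lebesgue_measure]_(t in D) (F n t)%:E =
    (del n * \sum_(k < n.+1) f (g n k.+1))%:E)%E.
  under eq_integral do rewrite /F -sumEFin.
  rewrite ge0_integral_sum //; last 2 first.
  - move=> k; apply/measurable_EFinP; apply: measurable_funM => //.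
    apply: measurable_indic; exact: measurable_itv.
  - move=> k t _; rewrite lee_fin mulr_ge0 //.
    by have /andP[] := fM (g n k.+1).
  rewrite mulr_sumr -sumEFin; apply: eq_bigr => k _.
  under eq_integral do rewrite EFinM.
  rewrite ge0_integralZl_EFin //; last 2 first.
  - by apply/measurable_EFinP; apply: measurable_indic; exact: measurable_itv.
  - by have /andP[] := fM (g n k.+1).
  rewrite integral_indic //; last exact: measurable_itv.
  rewrite setIidl; last first.
    move=> t; rewrite /cell /D /= !in_itv /= => /andP[h1 h2]; apply/andP; split.
      by apply: le_lt_trans h1; rewrite -(g0 n) gle.
    by apply: le_trans h2 _; rewrite -(gN n) gle.
  rewrite mulrC EFinM; congr (_ * _)%E.
  apply: etrans (lebesgue_measure_itv _) _ => /=.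
  by rewrite lte_fin gS ltrDl del0 -EFinB addrAC subrr add0r.
have lim : (\int[lebesgue_measure]_(t in D) (F n t)%:E)%E @[n --> \oo] -->
    (\int[lebesgue_measure]_(t in D) (f t)%:E)%E.
  apply: (@dominated_cvg _ _ R lebesgue_measure _ mD (fun n t => (F n t)%:E)
    (fun t => (f t)%:E) (cst M%:E)) => //.
  - by move=> n; apply/measurable_EFinP; exact: mF.
  - by move=> t Dt; apply: cvg_EFin; [exact: nearW|exact: cF].
  - apply: (@measurable_bounded_integrable _ _ _ _ (cst M)) => //.
    by exists M; split; [exact: num_real|move=> x Mx y _; rewrite /= ger0_norm // ltW].

have -> : \int[lebesgue_measure]_(t in `[a, b]) f t = \int[lebesgue_measure]_(t in D) f t.
  by rewrite /D Rintegral_itv_obnd_cbnd.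
have lim' : (b - a)^-1 * (del n * \sum_(k < n.+1) f (g n k.+1)) @[n --> \oo] -->
    (b - a)^-1 * \int[lebesgue_measure]_(t in D) f t.
  apply: cvgM; first exact: cvg_cst.
  have := @fine_cvg _ _ _ _ (fun n => \int[lebesgue_measure]_(t in D) (F n t)%:E)%E
    (fine (\int[lebesgue_measure]_(t in D) (f t)%:E)%E).
  rewrite fineK; last exact: integrable_fin_num fi.
  by move=> /(_ _ _ lim) /=; under eq_fun do rewrite intF.
have err : n.+1%:R^-1 * (f a - f b) @[n --> \oo] --> 0.
  rewrite -[X in _ --> X](mul0r (f a - f b)).
  apply: (@cvgM _ _ _ _ harmonic); [exact: cvg_harmonic|exact: cvg_cst].
have := cvgD lim' err; rewrite addr0.
suff E n : n.+1%:R^-1 * \sum_(k < n.+1) f (g n k) =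
    (b - a)^-1 * (del n * \sum_(k < n.+1) f (g n k.+1)) + n.+1%:R^-1 * (f a - f b).
  move=> cvD; rewrite (_ : (fun n => _) = fun n => (b - a)^-1 *
    (del n * \sum_(k < n.+1) f (g n k.+1)) + n.+1%:R^-1 * (f a - f b)); first exact: cvD.
  by apply/funext => n; exact: E.
rewrite [in LHS]big_ord_recl [in RHS]big_ord_recr /= g0 gN.
under [in LHS]eq_bigr do rewrite /bump leq0n add1n.
rewrite /del; move: (\sum_(i < n) _) => S; field.
by rewrite nat1r pnatr_eq0 /= gt_eqF.
Unshelve. all: by end_near. Qed.

Section Empirical.
Context {R : realType} {Omega : finType} (d : measure_display) (T : measurableType d).
Variables (Y : R -> T -> Omega) (a b : R).
Hypotheses (Yrc : right_cont_paths Y) (a_ge0 : 0 <= a) (ab : a < b).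

Definition riemann_frequency (n : nat) (w : T) (x : Omega) : R :=
  n.+1%:R^-1 * \sum_(k < n.+1) (Y (a + k%:R * ((b - a) / n.+1%:R)) w == x)%:R.

Lemma riemann_frequency_cvg w x :
  riemann_frequency n w x @[n --> \oo] --> empirical Y a b w x.
Proof.
apply: (@riemann_sum_cvg _ (fun t => (Y t w == x)%:R) a b 1) => // [t|t at_].
  by rewrite ler0n lern1 leq_b1.
have [eps eps0 H] := Yrc w (le_trans a_ge0 at_).
by exists eps => // s ts st; rewrite (H s).
Qed.

Lemma riemann_frequency_prob_vector n w : prob_vector (riemann_frequency n w).
Proof.
split=> [x|]; first by rewrite mulr_ge0 // sumr_ge0.
rewrite -mulr_sumr exchange_big /= (eq_bigr (fun=> 1)) => [|k _]; last first.
  rewrite (bigD1 (Y (a + k%:R * ((b - a) / n.+1%:R)) w)) //= eqxx big1 ?addr0 //.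
  by move=> x /negbTE; rewrite eq_sym => ->.
by rewrite sumr_const card_ord mulVf // pnatr_eq0.
Qed.

Lemma empirical_prob_vector w : prob_vector (empirical Y a b w).
Proof.
split=> [x|].
  have cv : riemann_frequency n w x @[n --> \oo] --> empirical Y a b w x.
    exact: riemann_frequency_cvg.
  rewrite -(cvg_lim _ cv) //; apply: limr_ge; first exact: cvgP cv.
  by apply: nearW => n; have [] := riemann_frequency_prob_vector n w.
have : \sum_x riemann_frequency n w x @[n --> \oo] --> \sum_x empirical Y a b w x.
  by apply: cvg_big => [|x _]; [exact: add_continuous|exact: riemann_frequency_cvg].
under eq_fun do rewrite (riemann_frequency_prob_vector _ _).2.
by move=> /cvg_lim <- //; rewrite lim_cst.
Qed.

Lemma measurable_empirical :
  (forall t x, 0 <= t -> measurable [set w | Y t w = x]) ->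
  forall x, measurable_fun setT (fun w => empirical Y a b w x).
Proof.
move=> mY x.
apply: (@measurable_fun_cvg _ _ _ _ (fun n w => riemann_frequency n w x)); last first.
  by move=> w _; exact: riemann_frequency_cvg.
move=> n; apply: measurable_funM => //; apply: measurable_sum => k.
set t := _ + _.
have t0 : 0 <= t by rewrite addr_ge0 // mulr_ge0 // divr_ge0 // subr_ge0 ltW.
rewrite (_ : (fun w => _) = \1_[set w | Y t w = x]).
  by apply: measurable_indic; exact: mY.
apply/funext => w; rewrite indicE; have [Yx|/eqP Yx] := eqVneq (Y t w) x.
  by rewrite mem_set.
by rewrite memNset.
Qed.

End Empirical.

(** * Expectations of bounded functions *)

Definition bounded_mfun (R : realType) d (T : measurableType d) (X : T -> R) :=
  measurable_fun setT X /\ exists M, forall w, `|X w| <= M.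

Section BoundedMfun.
Context {R : realType} {d : measure_display} {T : measurableType d}.
Implicit Types X Z : T -> R.

Lemma bounded_mfun_cst (c : R) : bounded_mfun (fun _ : T => c).
Proof. by split; [exact: measurable_cst|exists `|c|]. Qed.

Lemma bounded_mfunD X Z : bounded_mfun X -> bounded_mfun Z ->
  bounded_mfun (fun w => X w + Z w).
Proof.
move=> [mX [M XM]] [mZ [N ZN]]; split; first exact: measurable_funD.
by exists (M + N) => w; apply: le_trans (ler_normD _ _) (lerD _ _).
Qed.

Lemma bounded_mfunM X Z : bounded_mfun X -> bounded_mfun Z ->
  bounded_mfun (fun w => X w * Z w).
Proof.
move=> [mX [M XM]] [mZ [N ZN]]; split; first exact: measurable_funM.
by exists (M * N) => w; rewrite normrM ler_pM.
Qed.

Lemma bounded_mfunB X Z : bounded_mfun X -> bounded_mfun Z ->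
  bounded_mfun (fun w => X w - Z w).
Proof.
move=> bX bZ; under eq_fun do rewrite -mulN1r.
by apply: bounded_mfunD => //; apply: bounded_mfunM => //; exact: bounded_mfun_cst.
Qed.

Lemma bounded_mfunX X n : bounded_mfun X -> bounded_mfun (fun w => X w ^+ n).
Proof.
move=> bX; elim: n => [|n IH]; first exact: bounded_mfun_cst.
by under eq_fun do rewrite exprS; exact: bounded_mfunM.
Qed.

Lemma bounded_mfun_norm X : bounded_mfun X -> bounded_mfun (fun w => `|X w|).
Proof.
move=> [mX [M XM]]; split; first exact: measurableT_comp.
by exists M => w; rewrite normr_id.
Qed.

Lemma bounded_mfun_sum (I : Type) (r : seq I) (X : I -> T -> R) :
  (forall i, bounded_mfun (X i)) -> bounded_mfun (fun w => \sum_(i <- r) X i w).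
Proof.
move=> bX; elim: r => [|i r IH].
  by under eq_fun do rewrite big_nil; exact: bounded_mfun_cst.
by under eq_fun do rewrite big_cons; exact: bounded_mfunD.
Qed.

Lemma bounded_mfun_indic (A : set T) : measurable A -> bounded_mfun (\1_A : T -> R).
Proof.
move=> mA; split; first exact: measurable_indic.
by exists 1 => w; rewrite indicE; case: (_ \in _); rewrite ?normr1 ?normr0.
Qed.

Lemma bounded_mfun_bool (b : T -> bool) :
  measurable [set w | b w] -> bounded_mfun (fun w => (b w)%:R : R).
Proof.
move=> mb; rewrite (_ : (fun w => _) = \1_[set w | b w]); first exact: bounded_mfun_indic.
apply/funext => w; rewrite indicE; have [bw|/negP bw] := boolP (b w).
  by rewrite mem_set.
by rewrite memNset.
Qed.

Variable P : probability T R.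

Definition mean X : R := \int[P]_w X w.

Lemma bounded_mfun_integrable X : bounded_mfun X -> P.-integrable setT (EFin \o X).
Proof.
move=> [mX [M XM]]; apply: measurable_bounded_integrable => //.
  exact: le_lt_trans (probability_le1 P measurableT) (ltry 1).
exists M; split; first exact: num_real.
by move=> x Mx y _ /=; apply: le_trans (XM y) (ltW _).
Qed.

Lemma mean_cst (c : R) : mean (fun _ => c) = c.
Proof.
rewrite /mean Rintegral_cst // -[RHS]mulr1; congr (_ * _).
exact: (congr1 fine (probability_setT P)).
Qed.

Lemma meanD X Z : bounded_mfun X -> bounded_mfun Z ->
  mean (fun w => X w + Z w) = mean X + mean Z.
Proof. by move=> bX bZ; rewrite /mean RintegralD //; exact: bounded_mfun_integrable. Qed.

Lemma meanB X Z : bounded_mfun X -> bounded_mfun Z ->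
  mean (fun w => X w - Z w) = mean X - mean Z.
Proof. by move=> bX bZ; rewrite /mean RintegralB //; exact: bounded_mfun_integrable. Qed.

Lemma meanZ (c : R) X : bounded_mfun X -> mean (fun w => c * X w) = c * mean X.
Proof. by move=> bX; rewrite /mean RintegralZl //; exact: bounded_mfun_integrable. Qed.

Lemma mean_sum (I : Type) (r : seq I) (X : I -> T -> R) :
  (forall i, bounded_mfun (X i)) ->
  mean (fun w => \sum_(i <- r) X i w) = \sum_(i <- r) mean (X i).
Proof.
move=> bX; elim: r => [|i r IH].
  by under eq_fun do rewrite big_nil; rewrite mean_cst big_nil.
under eq_fun do rewrite big_cons.
by rewrite meanD // ?IH ?big_cons //; exact: bounded_mfun_sum.
Qed.

Lemma le_mean X Z : bounded_mfun X -> bounded_mfun Z ->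
  (forall w, X w <= Z w) -> mean X <= mean Z.
Proof.
by move=> bX bZ XZ; apply: le_Rintegral => //; exact: bounded_mfun_integrable.
Qed.

Lemma mean_cvg (X : nat -> T -> R) Z (M : R) :
  (forall n, bounded_mfun (X n)) -> (forall n w, `|X n w| <= M) ->
  (forall w, X n w @[n --> \oo] --> Z w) ->
  mean (X n) @[n --> \oo] --> mean Z.
Proof.
move=> bX XM cX.
have mZ : measurable_fun setT Z.
  apply: (@measurable_fun_cvg _ _ _ _ X) => [n|w _]; first exact: (bX n).1.
  exact: cX.
have bZ : bounded_mfun Z.
  split=> //; exists M => w; have /cvg_norm cv := cX w.
  rewrite -(cvg_lim _ cv) //; apply: limr_le; first exact: cvgP cv.
  exact: nearW.
have := @dominated_cvg _ _ R P _ measurableT (fun n w => (X n w)%:E)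
  (fun w => (Z w)%:E) (cst M%:E).
have ae0 := bounded_mfun_integrable bZ.
move=> H; rewrite /mean /Rintegral; apply: fine_cvg.
rewrite fineK; last exact: integrable_fin_num ae0.
apply: H => //.
- by move=> n; apply/measurable_EFinP; exact: (bX n).1.
- by move=> w _; apply: cvg_EFin; [exact: nearW|exact: cX].
- by apply: (@bounded_mfun_integrable (cst M)); exact: bounded_mfun_cst.
- by move=> n w _ /=; rewrite lee_fin.
Qed.
End BoundedMfun.

(** * Conditional centring and the martingale estimate *)

(** Measurability refers to the sigma-algebra generated by [G], which is [G]
    itself in all uses; stated through [bounded_mfun], it inherits the closure
    lemmas proved there. *)
Definition bounded_wrt (R : realType) d (T : measurableType d) (G : set (set T)) (X : T -> R) :=
  @bounded_mfun R _ (g_sigma_algebraType G) X.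

Section SubSigmaAlgebra.
Context {R : realType} {d : measure_display} {T : measurableType d}.
Implicit Types (G : set (set T)) (X Z : T -> R).

Lemma measurable_g_sigma G (A : set T) : sigma_algebra setT G -> 
  @measurable _ (g_sigma_algebraType G) A = G A.
Proof. by move=> sG; rewrite /measurable /= sigma_algebra_id. Qed.

Lemma bounded_wrtS G1 G2 X : sigma_algebra setT G1 -> sigma_algebra setT G2 ->
  G1 `<=` G2 -> bounded_wrt G1 X -> bounded_wrt G2 X.
Proof.
move=> s1 s2 G12 [mX bX]; split=> // _ B mB.
have := mX measurableT B mB; rewrite measurable_g_sigma // => /G12.
by rewrite -(measurable_g_sigma _ s2).
Qed.

Lemma bounded_wrt_mfun G X : sigma_algebra setT G -> G `<=` measurable ->
  bounded_wrt G X -> bounded_mfun X.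
Proof.
move=> s1 Gm [mX bX]; split=> // _ B mB.
by have := mX measurableT B mB; rewrite measurable_g_sigma // => /Gm.
Qed.

Lemma bounded_wrt_event G (Z : T -> bool) : sigma_algebra setT G -> 
  G [set w | Z w] -> bounded_wrt G (fun w => (Z w)%:R : R).
Proof. by move=> sG GZ; apply: bounded_mfun_bool; rewrite measurable_g_sigma. Qed.

(** The count is the integral part of [x] as long as this does not exceed [k];
    dividing by [k] approximates a number of the unit interval within [1 / k]. *)
Lemma layer_count (x : R) (k : nat) : 0 <= x ->
  (k%:R <= x -> \sum_(j < k) (j.+1%:R <= x)%R%:R = k%:R :> R) /\
  (x < k%:R -> x - 1 <= \sum_(j < k) (j.+1%:R <= x)%R%:R <= x).
Proof.
move=> x0; elim: k => [|k [IH1 IH2]].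
  by rewrite !big_ord0; split => // h; have := lt_le_trans h x0; rewrite ltxx.
rewrite big_ord_recr /= -natr1; split => [kx|xk].
  by rewrite kx IH1 //; apply: le_trans kx; rewrite lerDl.
rewrite (lt_geF xk) addr0; have [kx|kx] := leP k%:R x; last exact: IH2.
by rewrite (IH1 kx) kx andbT; lra.
Qed.

Variable P : probability T R.

(** Functions with values in the unit interval are uniform limits of
    combinations of their superlevel events. *)
Lemma mean_orthogonal G X Z :
  sigma_algebra setT G -> G `<=` measurable -> bounded_mfun Z ->
  (forall A, G A -> mean P (fun w => \1_A w * Z w) = 0) ->
  bounded_wrt G X -> mean P (fun w => X w * Z w) = 0.
Proof.
move=> sG Gm bZ orth bX.
have mZ0 : mean P Z = 0.
  have := orth setT; rewrite -(measurable_g_sigma _ sG) => /(_ measurableT) <-.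
  by congr (mean P _); apply/funext => w; rewrite indicE in_setT mul1r.
(* The general case reduces to the unit interval by an affine change. *)
have unit X' : bounded_wrt G X' -> (forall w, 0 <= X' w <= 1) ->
    mean P (fun w => X' w * Z w) = 0.
  move=> bX' X01; apply/eqP; rewrite -normr_eq0 eq_le normr_ge0 andbT.
  have [mZ [M ZM]] := bZ.
  have M0 : 0 <= M by exact: le_trans (ZM point).
  have bX'T := bounded_wrt_mfun sG Gm bX'.
  apply/ler_addgt0Pr => eps eps0; rewrite add0r.
  pose k := (Num.truncn (M / eps)).+1.
  pose Xk w : R := k%:R^-1 * \sum_(j < k) (j.+1%:R <= k%:R * X' w)%R%:R.
  have bj (j : 'I_k) : bounded_wrt G (fun w => (j.+1%:R <= k%:R * X' w)%R%:R : R).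
    apply: bounded_wrt_event => //; rewrite -(measurable_g_sigma _ sG).
    rewrite [X in measurable X](_ : _ =
        setT `&` (fun w => k%:R * X' w) @^-1` `[j.+1%:R, +oo[%classic).
      by apply: measurable_funM => //; exact: bX'.1.
    by rewrite setTI; apply/seteqP; split => w /=; rewrite in_itv /= andbT.
  have bXk : bounded_wrt G Xk.
    by apply: bounded_mfunM; [exact: bounded_mfun_cst|exact: bounded_mfun_sum].
  have bXkT := bounded_wrt_mfun sG Gm bXk.
  have orthk : mean P (fun w => Xk w * Z w) = 0.
    rewrite (_ : (fun w => _) = fun w => k%:R^-1 *
        \sum_(j < k) ((j.+1%:R <= k%:R * X' w)%R%:R * Z w)); last first.
      by apply/funext => w; rewrite /Xk -mulrA -mulr_suml.
    have bjZ (j : 'I_k) : bounded_mfun (fun w => (j.+1%:R <= k%:R * X' w)%R%:R * Z w).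
      by apply: bounded_mfunM => //; exact: bounded_wrt_mfun (bj j).
    rewrite meanZ; last exact: bounded_mfun_sum.
    rewrite mean_sum // big1 ?mulr0 // => j _.
    pose A := [set w | (j.+1%:R <= k%:R * X' w)%R].
    have GA : G A.
      have := (bj j).1 measurableT [set 1] (measurable_set1 _).
      rewrite measurable_g_sigma // setTI; congr (G _); apply/seteqP.
      by split=> w; rewrite /A /=; case: (_ <= _)%R => //= /esym/eqP; rewrite oner_eq0.
    rewrite -(orth A GA); congr mean; apply/funext => w; congr (_ * _).
    rewrite indicE /A; case: (boolP (_ <= _)%R) => h; first by rewrite mem_set.
    by rewrite memNset //=; exact/negP.
  have XXk w : `|X' w - Xk w| <= k%:R^-1.
    have k0 : 0 < k%:R :> R by rewrite ltr0n.
    have /andP[x0 x1] := X01 w.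
    have [L1 L2] := @layer_count (k%:R * X' w) k (mulr_ge0 (ltW k0) x0).
    have : k%:R * X' w - 1 <= k%:R * Xk w <= k%:R * X' w.
      rewrite /Xk mulrA divff ?gt_eqF // mul1r.
      have [kx|kx] := leP k%:R (k%:R * X' w); last exact: L2.
      rewrite L1 // kx andbT.
      have : k%:R * X' w <= k%:R by rewrite ler_piMr // ltW.
      by lra.
    have kV : k%:R * k%:R^-1 = 1 :> R by rewrite divff ?gt_eqF.
    move=> /andP[h1 h2]; rewrite ler_norml; apply/andP; split; nra.
  have -> : mean P (fun w => X' w * Z w) = mean P (fun w => (X' w - Xk w) * Z w).
    rewrite -[LHS]subr0 -orthk -meanB; try exact: bounded_mfunM.
    by congr mean; apply/funext => w; rewrite mulrBl.
  have bD : bounded_mfun (fun w => (X' w - Xk w) * Z w).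
    by apply: bounded_mfunM => //; exact: bounded_mfunB.
  apply: le_trans (le_normr_Rintegral _ (bounded_mfun_integrable P bD)) _ => //.
  apply: (@le_trans _ _ (mean P (fun=> k%:R^-1 * M))).
    apply: le_mean => [||w]; [exact: bounded_mfun_norm|exact: bounded_mfun_cst|].
    by rewrite normrM ler_pM.
  rewrite mean_cst mulrC ler_pdivrMr ?ltr0n // mulrC -ler_pdivrMr // ltW //.
  exact: truncnS_gt.
have [mX [M XM]] := bX.
have M0 : 0 <= M by exact: le_trans (XM point).
have M1 : 0 < 2 * (M + 1) by rewrite mulr_gt0 // ltr_wpDl.
pose X' w : R := (2 * (M + 1))^-1 * (X w + (M + 1)).
have bX' : bounded_wrt G X'.
  apply: bounded_mfunM; first exact: bounded_mfun_cst.
  by apply: bounded_mfunD => //; exact: bounded_mfun_cst.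
have X'01 w : 0 <= X' w <= 1.
  have := XM w; rewrite ler_norml => /andP[h1 h2]; rewrite /X'; apply/andP; split.
    by rewrite mulr_ge0 ?invr_ge0 ?(ltW M1) //; lra.
  by rewrite mulrC ler_pdivrMr // mul1r; lra.
have bXT := bounded_wrt_mfun sG Gm bX.
have -> : (fun w => X w * Z w) = fun w => 2 * (M + 1) * (X' w * Z w) - (M + 1) * Z w.
  apply/funext => w; rewrite /X' !mulrA divff ?gt_eqF // mul1r -mulrBl; congr (_ * _); ring.
have bX'T := bounded_wrt_mfun sG Gm bX'.
have bXZ : bounded_mfun (fun w => X' w * Z w) by exact: bounded_mfunM.
rewrite meanB; [|by apply: bounded_mfunM => //; exact: bounded_mfun_cst..].
rewrite !meanZ //.
by rewrite unit // mZ0 !mulr0 subrr.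
Qed.
End SubSigmaAlgebra.

Lemma sum_eqM (R : pzSemiRingType) (I : finType) (i : I) (F : I -> R) :
  \sum_j (i == j)%:R * F j = F i.
Proof.
rewrite (bigD1 i) //= eqxx mul1r big1 ?addr0 // => j /negbTE.
by rewrite eq_sym => ->; rewrite mul0r.
Qed.

Section MartingaleEstimate.
Context {R : realType} {Omega : finType} {d : measure_display} {T : measurableType d}.
Variable P : probability T R.

(** A quantity indexed by the current state is a finite sum over the events
    that fix that state. *)
Lemma bounded_wrt_state (G : set (set T)) (Y : T -> Omega) (F : Omega -> T -> R) :
  sigma_algebra setT G -> (forall x, G [set w | Y w = x]) ->
  (forall x, bounded_wrt G (F x)) -> bounded_wrt G (fun w => F (Y w) w).
Proof.
move=> sG GY bF; under eq_fun => w do rewrite -(sum_eqM (Y w) (fun x => F x w)).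
apply: bounded_mfun_sum => x; apply: bounded_mfunM; last exact: bF.
apply: bounded_wrt_event => //; rewrite (_ : [set _ | _] = [set w | Y w = x]) //.
by apply/seteqP; split => w /= /eqP.
Qed.

Variables (G : nat -> set (set T)) (Y : nat -> T -> Omega).
Variables (p q : T -> Omega -> Omega -> R) (h f : T -> Omega -> R).
Variables (N : nat) (del B K H : R).
Hypothesis G_sigma : forall k, sigma_algebra setT (G k).
Hypothesis G_meas : forall k, G k `<=` measurable.
Hypothesis G_incr : forall k, G k `<=` G k.+1.
Hypothesis Y_adapt : forall k x, G k [set w | Y k w = x].
Hypothesis p_G0 : forall x y, bounded_wrt (G 0%N) (fun w => p w x y).
Hypothesis h_G0 : forall x, bounded_wrt (G 0%N) (fun w => h w x).
Hypothesis f_G0 : forall x, bounded_wrt (G 0%N) (fun w => f w x).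
Hypothesis Y_markov : forall k x y A, (k < N)%N -> G k A ->
  mean P (fun w => \1_A w * ((Y k w == x)%:R * ((Y k.+1 w == y)%:R - p w x y))) = 0.
Hypothesis del01 : 0 <= del <= 1.
Hypothesis q_le : forall w x y, `|q w x y| <= B.
Hypothesis h_le : forall w x, `|h w x| <= H.
Hypothesis K_ge0 : 0 <= K.
Hypothesis p_exp : forall w x y,
  `|p w x y - (x == y)%:R - del * q w x y| <= K * del ^+ 2.
Hypothesis poisson_h : forall w x, \sum_y q w x y * h w y = f w x.

Local Notation m := (#|Omega|%:R : R).

Lemma G_mono k (X : T -> R) : bounded_wrt (G 0%N) X -> bounded_wrt (G k) X.
Proof.
move=> bX; elim: k => // k IH.
exact: bounded_wrtS (G_sigma k) (G_sigma k.+1) (G_incr (k := k)) IH.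
Qed.

Lemma bounded_wrt_next k (X : T -> R) : bounded_wrt (G k) X -> bounded_wrt (G k.+1) X.
Proof. exact: bounded_wrtS (G_sigma k) (G_sigma k.+1) (G_incr (k := k)). Qed.

Lemma G_bounded k (X : T -> R) : bounded_wrt (G k) X -> bounded_mfun X.
Proof. exact: bounded_wrt_mfun (G_sigma k) (G_meas (k := k)). Qed.

Lemma visit_wrt k x : bounded_wrt (G k) (fun w => (Y k w == x)%:R : R).
Proof.
apply: bounded_wrt_event => //; rewrite (_ : [set _ | _] = [set w | Y k w = x]) //.
by apply/seteqP; split => w /= /eqP.
Qed.

(** Given the events of [G k], the law of [Y k.+1] is row [Y k] of [p]; the
    weights [psi] are known at that time, so they factor out. *)
Lemma conditional_centring k (psi : Omega -> T -> R) :
  (k < N)%N -> (forall y, bounded_wrt (G k) (psi y)) ->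
  mean P (fun w => \sum_y psi y w * ((Y k.+1 w == y)%:R - p w (Y k w) y)) = 0.
Proof.
move=> kN bpsi.
rewrite (_ : (fun w => _) = fun w => \sum_x \sum_y
    psi y w * ((Y k w == x)%:R * ((Y k.+1 w == y)%:R - p w x y))); last first.
  apply/funext => w; rewrite exchange_big /=; apply: eq_bigr => y _.
  by rewrite -mulr_sumr sum_eqM.
have bZ x y : bounded_mfun (fun w => (Y k w == x)%:R * ((Y k.+1 w == y)%:R - p w x y)).
  apply: bounded_mfunM; first exact: G_bounded (visit_wrt k x).
  by apply: bounded_mfunB; [exact: G_bounded (visit_wrt _ y)|exact: G_bounded (p_G0 x y)].
have bpZ x y : bounded_mfun
    (fun w => psi y w * ((Y k w == x)%:R * ((Y k.+1 w == y)%:R - p w x y))).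
  by apply: bounded_mfunM => //; exact: G_bounded (bpsi y).
rewrite mean_sum => [|x]; last exact: bounded_mfun_sum.
apply: big1 => x _; rewrite mean_sum //; apply: big1 => y _.
by apply: (mean_orthogonal (G_sigma k)) => // A GA; exact: Y_markov.
Qed.

(** The conditional mean of [h] at the next state. *)
Definition drifted k w := \sum_y p w (Y k w) y * h w y.
Definition increment k w := h w (Y k.+1 w) - drifted k w.

Lemma drifted_wrt k : bounded_wrt (G k) (drifted k).
Proof.
apply: (bounded_wrt_state (G := G k) (Y := Y k) (F := fun x w => \sum_y p w x y * h w y)) => // x.
by apply: bounded_mfun_sum => y; apply: bounded_mfunM; exact: G_mono.
Qed.

Lemma increment_wrt k : bounded_wrt (G k.+1) (increment k).
Proof.
apply: bounded_mfunB; last exact: bounded_wrt_next (drifted_wrt k).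
apply: (bounded_wrt_state (G := G k.+1) (Y := Y k.+1) (F := fun x w => h w x)) => // x.
exact: G_mono.
Qed.

Lemma partial_sum_wrt k : bounded_wrt (G k) (fun w => \sum_(j < k) increment j w).
Proof.
elim: k => [|k IH].
  by under eq_fun do rewrite big_ord0; exact: bounded_mfun_cst.
under eq_fun do rewrite big_ord_recr /=.
by apply: bounded_mfunD; [exact: bounded_wrt_next|exact: increment_wrt].
Qed.

Lemma incrementE k w :
  increment k w = \sum_y h w y * ((Y k.+1 w == y)%:R - p w (Y k w) y).
Proof.
rewrite /increment -(sum_eqM (Y k.+1 w) (h w)) /drifted -sumrB.
by apply: eq_bigr => y _; ring.
Qed.

Definition deviation_cst : R := B + K.
Definition increment_cst : R :=
  (m * deviation_cst * H) ^+ 2 +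
  m * deviation_cst * (H + m * (1 + deviation_cst) * H) ^+ 2.

Lemma p_near_id w x y : `|p w x y - (x == y)%:R| <= deviation_cst * del.
Proof.
have /andP[d0 d1] := del01.
rewrite -(subrK (del * q w x y) (_ - _)).
apply: le_trans (ler_normD _ _) _; rewrite normrM (ger0_norm d0).
have dd : del ^+ 2 <= del by rewrite expr2 ler_piMl.
have := ler_wpM2l K_ge0 dd; have := ler_wpM2l d0 (q_le w x y).
by have := p_exp w x y; rewrite /deviation_cst; lra.
Qed.

(** Centring replaces the square of the increment by its conditional mean, the
    spread of [h] around its drifted value under row [Y k] of [p].  The current
    state contributes a displacement of order [del], squared, and the other
    states together have probability of order [del]. *)
Lemma increment_var k : (k < N)%N ->
  mean P (fun w => increment k w ^+ 2) <= increment_cst * del.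
Proof.
move=> kN; have /andP[d0 d1] := del01.
pose psi y w := (h w y - drifted k w) ^+ 2.
have bpsi y : bounded_wrt (G k) (psi y).
  by apply: bounded_mfunX; apply: bounded_mfunB; [exact: G_mono|exact: drifted_wrt].
have bp : bounded_wrt (G k) (fun w => \sum_y psi y w * p w (Y k w) y).
  apply: bounded_mfun_sum => y; apply: bounded_mfunM; first exact: bpsi.
  apply: (bounded_wrt_state (G := G k) (Y := Y k) (F := fun x w => p w x y)) => // x.
  exact: G_mono.
have -> : (fun w => increment k w ^+ 2) = fun w =>
    \sum_y psi y w * ((Y k.+1 w == y)%:R - p w (Y k w) y) + \sum_y psi y w * p w (Y k w) y.
  apply/funext => w; rewrite -big_split /= /increment.
  under eq_bigr do rewrite -mulrDr subrK mulrC.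
  by rewrite sum_eqM.
rewrite meanD; last 2 first.
- apply: bounded_mfun_sum => y; apply: bounded_mfunM; first exact: G_bounded (bpsi y).
  apply: bounded_mfunB; first exact: G_bounded (visit_wrt _ y).
  apply: (@G_bounded k).
  apply: (bounded_wrt_state (G := G k) (Y := Y k) (F := fun x w => p w x y)) => // x.
  exact: G_mono.
- exact: G_bounded bp.
rewrite conditional_centring // add0r -[leRHS](mean_cst P).
apply: le_mean; [exact: G_bounded bp|exact: bounded_mfun_cst|move=> w].
set x := Y k w; have C0 : 0 <= deviation_cst.
  by rewrite addr_ge0 //; apply: le_trans (q_le w x x).
have H0 : 0 <= H by apply: le_trans (h_le w x).
have Cd1 : deviation_cst * del <= deviation_cst by rewrite ler_piMr.
have p_le y : p w x y <= (x == y)%:R + deviation_cst * del.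
  by have := p_near_id w x y; rewrite ler_norml; lra.
have p_abs y : `|p w x y| <= 1 + deviation_cst.
  have := p_near_id w x y; rewrite !ler_norml; case: (x == y) => /=; lra.
have drift_abs : `|drifted k w| <= m * ((1 + deviation_cst) * H).
  apply: le_trans (ler_norm_sum _ _ _) _.
  rewrite [leRHS]mulr_natl -sumr_const; apply: ler_sum => y _.
  by rewrite normrM ler_pM.
have psi_le y : psi y w <= (H + m * ((1 + deviation_cst) * H)) ^+ 2.
  have D0 : 0 <= m * ((1 + deviation_cst) * H).
    by apply: mulr_ge0 => //; apply: mulr_ge0 => //; exact: addr_ge0.
  rewrite /psi -real_normK ?num_real // lerXn2r ?nnegrE //; first exact: addr_ge0.
  exact: le_trans (ler_normB _ _) (lerD (h_le _ _) drift_abs).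
have psi_x : psi x w <= (m * deviation_cst * H) ^+ 2 * del.
  apply: (@le_trans _ _ ((m * deviation_cst * H * del) ^+ 2)); last first.
    rewrite exprMn ler_wpM2l ?sqr_ge0 // expr2 ler_piMl //.
  have -> : psi x w = (\sum_y (p w x y - (x == y)%:R) * h w y) ^+ 2.
    rewrite /psi -sqrrN opprB -(sum_eqM x (h w)) /drifted -sumrB.
    by congr (_ ^+ 2); apply: eq_bigr => y _; ring.
  rewrite -real_normK ?num_real // lerXn2r ?nnegrE //; first by rewrite !mulr_ge0.
  apply: le_trans (ler_norm_sum _ _ _) _.
  rewrite -!mulrA [leRHS]mulr_natl -sumr_const; apply: ler_sum => y _.
  by rewrite normrM [H * del]mulrC mulrA ler_pM // p_near_id.
apply: (@le_trans _ _ (\sum_y ((x == y)%:R * psi y w +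
    deviation_cst * del * (H + m * ((1 + deviation_cst) * H)) ^+ 2))).
  apply: ler_sum => y _; apply: le_trans (ler_wpM2l (sqr_ge0 _) (p_le y)) _.
  by have := ler_wpM2l (mulr_ge0 C0 d0) (psi_le y); rewrite -/(psi y w); lra.
rewrite big_split /= sum_eqM sumr_const /increment_cst -[_ *+ _]mulr_natl.
rewrite [leRHS]mulrDl lerD // -[m * (1 + _) * H]mulrA le_eqVlt; apply/orP; left; apply/eqP.
by ring.
Qed.

(** Orthogonality of martingale differences: the cross terms are centred. *)
Lemma partial_sum_var k : (k <= N)%N ->
  mean P (fun w => (\sum_(j < k) increment j w) ^+ 2) <= k%:R * (increment_cst * del).
Proof.
elim: k => [|k IH] kN.
  by under eq_fun do rewrite big_ord0 expr0n /=; rewrite mean_cst mul0r.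
pose S w := \sum_(j < k) increment j w.
have bS : bounded_wrt (G k) S by exact: partial_sum_wrt.
have bD : bounded_mfun (increment k) by exact: G_bounded (increment_wrt k).
have bST := G_bounded bS.
have cross : mean P (fun w => S w * increment k w) = 0.
  rewrite -(conditional_centring (psi := fun y w => S w * h w y) kN) => [|y].
    congr mean; apply/funext => w; rewrite incrementE mulr_sumr.
    by apply: eq_bigr => y _; rewrite mulrA.
  by apply: bounded_mfunM => //; exact: G_mono.
have bSD : bounded_mfun (fun w => S w * increment k w) by exact: bounded_mfunM.
rewrite (_ : (fun w => _) = fun w =>
    S w ^+ 2 + (2 * (S w * increment k w) + increment k w ^+ 2)); last first.
  by apply/funext => w; rewrite big_ord_recr /= -/(S w); ring.
have b2SD : bounded_mfun (fun w => 2 * (S w * increment k w)).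
  by apply: bounded_mfunM => //; exact: bounded_mfun_cst.
have bD2 : bounded_mfun (fun w => increment k w ^+ 2) by exact: bounded_mfunX.
rewrite meanD //; [|exact: bounded_mfunX|exact: bounded_mfunD].
rewrite meanD // meanZ // cross mulr0 add0r -natr1 mulrDl mul1r lerD //.
  exact: IH (ltnW kN).
exact: increment_var.
Qed.

(** The increments of [h] along the path telescope; their predictable part is
    [del q h = del f] up to the second-order error of the expansion of [p]. *)
Lemma additive_functional_decomp n w :
  `|\sum_(k < n) del * f w (Y k w) - (h w (Y n w) - h w (Y 0%N w)) +
     \sum_(k < n) increment k w| <= n%:R * (m * (K * del ^+ 2 * H)).
Proof.
elim: n => [|n IH]; first by rewrite !big_ord0 subrr subrr addr0 normr0 mul0r.
rewrite !big_ord_recr /= -natr1 [leRHS]mulrDl mul1r.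
set x := Y n w.
have rho : `|drifted n w - h w x - del * f w x| <= m * (K * del ^+ 2 * H).
  rewrite (_ : _ - _ - _ = \sum_y (p w x y - (x == y)%:R - del * q w x y) * h w y).
    apply: le_trans (ler_norm_sum _ _ _) _.
    rewrite [leRHS]mulr_natl -sumr_const; apply: ler_sum => y _.
    by rewrite normrM ler_pM.
  rewrite -(sum_eqM x (h w)) -poisson_h /drifted mulr_sumr -!sumrB.
  by apply: eq_bigr => y _; ring.
apply: le_trans (lerD IH rho); apply: le_trans (ler_normB _ _).
rewrite /increment le_eqVlt; apply/orP; left; apply/eqP; congr (`|_|).
by rewrite -/x; ring.
Qed.

Lemma additive_functional_var :
  mean P (fun w => (\sum_(k < N) del * f w (Y k w)) ^+ 2) <=
  2 * (2 * H + N%:R * (m * (K * del ^+ 2 * H))) ^+ 2 + 2 * (N%:R * (increment_cst * del)).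
Proof.
pose S w := \sum_(k < N) increment k w.
have bS2 : bounded_mfun (fun w => S w ^+ 2).
  by apply: bounded_mfunX; exact: G_bounded (partial_sum_wrt N).
have b2S2 : bounded_mfun (fun w => 2 * S w ^+ 2).
  by apply: bounded_mfunM => //; exact: bounded_mfun_cst.
set U := _ + N%:R * _.
apply: (@le_trans _ _ (mean P (fun w => 2 * U ^+ 2 + 2 * S w ^+ 2))); last first.
  rewrite meanD //; last exact: bounded_mfun_cst.
  by rewrite mean_cst meanZ // lerD2l ler_wpM2l // partial_sum_var.
apply: le_mean; [|by apply: bounded_mfunD => //; exact: bounded_mfun_cst|move=> w].
  apply: bounded_mfunX; apply: bounded_mfun_sum => k.
  apply: bounded_mfunM; first exact: bounded_mfun_cst.
  apply: (@G_bounded k).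
  apply: (bounded_wrt_state (G := G k) (Y := Y k) (F := fun x w => f w x)) => // x.
  exact: G_mono.
have := additive_functional_decomp N w; set A := \sum_(k < N) _; rewrite -/(S w) => dec.
have AS : `|A + S w| <= U.
  rewrite (_ : A + S w = (A - (h w (Y N w) - h w (Y 0%N w)) + S w) +
    (h w (Y N w) - h w (Y 0%N w))); last by ring.
  apply: le_trans (ler_normD _ _) _; rewrite /U addrC lerD //.
  by apply: le_trans (ler_normB _ _) _; rewrite mulr2n mulrDl mul1r lerD.
have : (A + S w) ^+ 2 <= U ^+ 2.
  by rewrite -[leLHS]real_normK ?num_real // lerXn2r ?nnegrE // (le_trans _ AS).
have := sqr_ge0 (A + 2 * S w); nra.
Qed.

End MartingaleEstimate.

(** * One observation interval *)

Section Interval.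
Context {R : realType} {Omega : finType} {d : measure_display} {T : measurableType d}.
Variables (P : probability T R) (F : R -> set (set T)) (Y : R -> T -> Omega).
Hypotheses (F_filt : filtration F) (Y_adapt : adapted F Y).

Lemma mean_indic (A : set T) : measurable A -> mean P (\1_A) = fine (P A).
Proof. by move=> mA; rewrite /mean /Rintegral integral_indic // setIT. Qed.

Lemma mean_indicM (A : set T) (X : T -> R) :
  mean P (fun w => \1_A w * X w) = \int[P]_(w in A) X w.
Proof.
rewrite Rintegral_mkcond; congr mean; apply/funext => w.
rewrite /patch indicE; case: (w \in A); [exact: mul1r|exact: mul0r].
Qed.

(** The Markov property, for events of the past, as the orthogonality relation
    required by [conditional_centring]. *)
Lemma markov_on_centred (a b s t : R) (q : T -> Omega -> Omega -> R) x y (A : set T) :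
  0 <= a -> markov_on P F Y a b q -> a <= s -> s <= t -> t <= b -> F s A ->
  bounded_mfun (fun w => transition (q w) (t - s) x y) ->
  mean P (fun w => \1_A w * ((Y s w == x)%:R *
    ((Y t w == y)%:R - transition (q w) (t - s) x y))) = 0.
Proof.
move=> a0 mk as_ st tb FA btr; have [F_sigma F_meas F_incr] := F_filt.
have s0 : 0 <= s by exact: le_trans as_.
have t0 : 0 <= t by exact: le_trans st.
pose D := A `&` [set w | Y s w = x]; pose E := D `&` [set w | Y t w = y].
have mD : measurable D.
  by apply: measurableI; apply: (F_meas s s0) => //; exact: Y_adapt.
have mE : measurable E.
  by apply: measurableI => //; apply: (F_meas t t0); exact: Y_adapt.
have eqI (u : R) z w : (Y u w == z)%:R = \1_[set w | Y u w = z] w :> R.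
  rewrite indicE; have [h|/eqP h] := eqVneq (Y u w) z; first by rewrite mem_set.
  by rewrite memNset.
rewrite (_ : (fun w => _) = fun w => \1_E w - \1_D w * transition (q w) (t - s) x y); last first.
  by apply/funext => w; rewrite !eqI /E /D !indicI /=; ring.
rewrite meanB; last 2 first.
- exact: bounded_mfun_indic.
- by apply: bounded_mfunM => //; exact: bounded_mfun_indic.
by rewrite mean_indic // mean_indicM (mk s t x y A as_ st tb FA) subrr.
Qed.

Variables (a b : R) (q : T -> Omega -> Omega -> R) (B H : R).
Variables (h : T -> Omega -> R) (p : T -> R) (x : Omega).
Hypotheses (Y_rc : right_cont_paths Y) (a_ge0 : 0 <= a) (ab1 : 1 <= b - a).
Hypothesis Y_markov : markov_on P F Y a b q.
Hypothesis q_le : forall w y z, `|q w y z| <= B.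
Hypothesis h_le : forall w y, `|h w y| <= H.
Hypothesis q_F : forall y z, bounded_wrt (F a) (fun w => q w y z).
Hypothesis h_F : forall y, bounded_wrt (F a) (fun w => h w y).
Hypothesis p_F : bounded_wrt (F a) p.
Hypothesis poisson_h : forall w y, \sum_z q w y z * h w z = (y == x)%:R - p w.

Local Notation m := (#|Omega|%:R : R).

Definition mean_square_cst : R :=
  let K := expR (m * B) in
  2 * ((2 + m * K) * H) ^+ 2 + 2 * increment_cst (Omega := Omega) B K H.

(** The condition on [n] makes the mesh times the length of the interval at
    most [1], so that the second-order errors accumulated over the whole
    subdivision stay bounded. *)
Lemma riemann_frequency_mean_square n : (b - a) ^+ 2 <= n.+1%:R ->
  mean P (fun w => (riemann_frequency Y a b n w x - p w) ^+ 2) <= mean_square_cst / (b - a).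
Proof.
move=> nbig; have [F_sigma F_meas F_incr] := F_filt.
set Del := b - a in nbig *; set del := Del / n.+1%:R.
have Del1 : 1 <= Del by exact: ab1.
have Del0 : 0 < Del by exact: lt_le_trans Del1.
have N0 : 0 < n.+1%:R :> R by [].
have del0 : 0 <= del by rewrite divr_ge0 // ltW.
have Ndel : n.+1%:R * del = Del by rewrite /del mulrC divfK // gt_eqF.
have Ddel : Del * del <= 1 by rewrite /del mulrA ler_pdivrMr // mul1r -expr2.
have del1 : del <= 1 by apply: le_trans Ddel; rewrite ler_peMl.
pose time k := a + k%:R * del.
have time0 k : 0 <= time k by rewrite addr_ge0 // mulr_ge0.
have timeS k : time k.+1 = time k + del by rewrite /time -natr1 mulrDl mul1r addrA.
have time_init : time 0%N = a by rewrite /time mul0r addr0.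
have K0 : 0 <= expR (m * B) by exact: expR_ge0.
have tr_F y z : bounded_wrt (F a) (fun w => transition (q w) del y z).
  split.
    apply: (@measurable_transition _ _ _ _ _ B) => // u v; exact: (q_F u v).1.
  exists (1 + B + expR (m * B)) => w.
  have te := @transition_expansion _ _ (q w) B del y z (q_le w) del0 del1.
  have {}te : `|transition (q w) del y z - (y == z)%:R - del * q w y z| <= expR (m * B).
    by apply: le_trans te _; rewrite ler_piMr // exprn_ile1.
  have dq : `|del * q w y z| <= B.
    by rewrite normrM ger0_norm // (le_trans _ (q_le w y z)) // ler_piMl.
  by move: te dq; rewrite !ler_norml; case: (y == z) => /=; lra.
have V0 := @additive_functional_var R Omega d T P (fun k => F (time k))
  (fun k => Y (time k)) (fun w => transition (q w) del) q h
  (fun w y => (y == x)%:R - p w) n.+1 del B (expR (m * B)) H.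
have {V0} : mean P (fun w => (\sum_(k < n.+1) del * ((Y (time k) w == x)%:R - p w)) ^+ 2) <=
    2 * (2 * H + n.+1%:R * (m * (expR (m * B) * del ^+ 2 * H))) ^+ 2 +
    2 * (n.+1%:R * (increment_cst (Omega := Omega) B (expR (m * B)) H * del)).
  apply: V0 => //.
  - by move=> k; exact: F_sigma.
  - by move=> k; exact: F_meas.
  - by move=> k; apply: F_incr => //; rewrite timeS lerDl.
  - by move=> k y; apply: Y_adapt.
  - by move=> y z; rewrite time_init.
  - by move=> y; rewrite time_init.
  - move=> y; rewrite time_init; apply: bounded_mfunB => //; exact: bounded_mfun_cst.
  - move=> k y z A kN FA.
    have dE : time k.+1 - time k = del by rewrite timeS addrAC subrr add0r.
    rewrite -dE; apply: (markov_on_centred a_ge0 Y_markov) => //.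
    + by rewrite /time lerDl mulr_ge0.
    + by rewrite timeS lerDl.
    + by rewrite /time -lerBrDl -/Del -Ndel ler_wpM2r // ler_nat.
    + by rewrite dE; apply: (bounded_wrt_mfun _ _ (tr_F y z)); [exact: F_sigma|exact: F_meas].
  - by rewrite del0.
  - by move=> w y z; exact: transition_expansion.
set V := increment_cst _ _ _.
set K := expR _ in V *.
have bfreq : bounded_mfun (fun w => riemann_frequency Y a b n w x - p w).
  apply: bounded_mfunB; last by apply: bounded_wrt_mfun p_F; [exact: F_sigma|exact: F_meas].
  apply: bounded_mfunM; first exact: bounded_mfun_cst.
  apply: bounded_mfun_sum => k; apply: bounded_mfun_bool.
  rewrite (_ : [set w | _] = [set w | Y (time k) w = x]).
    by apply: (F_meas (time k)) => //; exact: Y_adapt.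
  by apply/seteqP; split => w /= /eqP.
rewrite (_ : (fun w => _) = fun w => Del ^+ 2 * (riemann_frequency Y a b n w x - p w) ^+ 2);
    last first.
  apply/funext => w; rewrite -exprMn; congr (_ ^+ 2).
  rewrite -mulr_sumr sumrB sumr_const card_ord /riemann_frequency -[p w *+ _]mulr_natl.
  rewrite [LHS]mulrBr [RHS]mulrBr [del * (n.+1%:R * _)]mulrA [del * n.+1%:R]mulrC.
  rewrite Ndel; congr (_ - _).
  by rewrite mulrA.
rewrite meanZ; last exact: bounded_mfunX.
move=> V0; rewrite ler_pdivlMr // -(ler_pM2l Del0) mulrCA -expr2.
rewrite [leLHS]mulrC; apply: le_trans V0 _.
have V_ge0 : 0 <= V.
  rewrite /V /increment_cst /deviation_cst.
  have HH : 0 <= H by exact: le_trans (h_le point x).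
  have BB : 0 <= B by exact: le_trans (q_le point x x).
  by rewrite addr_ge0 ?sqr_ge0 // mulr_ge0 ?sqr_ge0 // mulr_ge0 // addr_ge0.
have HH : 0 <= H by exact: le_trans (h_le point x).
have -> : n.+1%:R * (m * (K * del ^+ 2 * H)) = m * K * H * (Del * del).
  by rewrite -Ndel; ring.
have -> : n.+1%:R * (V * del) = Del * V by rewrite -Ndel; ring.
have mKH : 0 <= m * K * H by rewrite mulr_ge0 // mulr_ge0.
have mono : (2 * H + m * K * H * (Del * del)) ^+ 2 <= ((2 + m * K) * H) ^+ 2.
  have le_U : 2 * H + m * K * H * (Del * del) <= (2 + m * K) * H.
    by rewrite [leRHS]mulrDl lerD2l ler_piMr.
  have U_ge0 : 0 <= 2 * H + m * K * H * (Del * del).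
    by apply: addr_ge0; apply: mulr_ge0 => //; apply: mulr_ge0 => //; exact: ltW.
  by rewrite lerXn2r ?nnegrE // (le_trans _ le_U).
rewrite /mean_square_cst /= -/K -/V [leRHS]mulrDr lerD //; last by rewrite mulrCA.
apply: (@le_trans _ _ (2 * ((2 + m * K) * H) ^+ 2)); first by rewrite ler_wpM2l.
by rewrite ler_peMl // mulr_ge0 // sqr_ge0.
Qed.

Lemma empirical_mean_square :
  mean P (fun w => (empirical Y a b w x - p w) ^+ 2) <= mean_square_cst / (b - a).
Proof.
have [F_sigma F_meas F_incr] := F_filt.
have ab : a < b by rewrite -subr_gt0; exact: lt_le_trans ab1.
have bp : bounded_mfun p.
  by apply: bounded_wrt_mfun p_F; [exact: F_sigma|exact: F_meas].
have [mp [M pM]] := bp.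
have cv : mean P (fun w => (riemann_frequency Y a b n w x - p w) ^+ 2) @[n --> \oo] -->
    mean P (fun w => (empirical Y a b w x - p w) ^+ 2).
  apply: (@mean_cvg _ _ _ P (fun n w => (riemann_frequency Y a b n w x - p w) ^+ 2)
    _ ((1 + M) ^+ 2)) => [n|n w|w].
  - apply: bounded_mfunX; apply: bounded_mfunB => //.
    apply: bounded_mfunM; first exact: bounded_mfun_cst.
    apply: bounded_mfun_sum => k; apply: bounded_mfun_bool.
    set t := _ + _; have t0 : 0 <= t by rewrite addr_ge0 // mulr_ge0 // divr_ge0 // subr_ge0 ltW.
    rewrite (_ : [set w | _] = [set w | Y t w = x]).
      by apply: (F_meas t t0); exact: Y_adapt.
    by apply/seteqP; split => w /= /eqP.
  - have [f0 f1] := riemann_frequency_prob_vector Y a b n w.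
    have fx1 : riemann_frequency Y a b n w x <= 1.
      by rewrite -f1 (bigD1 x) //= lerDl sumr_ge0.
    have M0 : 0 <= M by exact: le_trans (pM w).
    rewrite normrX lerXn2r ?nnegrE ?addr_ge0 //.
    by apply: le_trans (ler_normB _ _) _; rewrite lerD // ger0_norm.
  have cvB : riemann_frequency Y a b n w x - p w @[n --> \oo] --> empirical Y a b w x - p w.
    apply: cvgB; last exact: cvg_cst.
    exact: riemann_frequency_cvg.
  by under eq_fun do rewrite expr2; rewrite expr2; apply: cvgM.
rewrite -(cvg_lim _ cv) //; apply: limr_le; first exact: cvgP cv.
exists (Num.truncn ((b - a) ^+ 2)) => // n /= Nn.
apply: riemann_frequency_mean_square; apply/ltW.
by apply: lt_le_trans (truncnS_gt _) _; rewrite ler_nat ltnS.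
Qed.

End Interval.

Lemma mean_square_cst_ge0 (R : realType) (Omega : finType) (B H : R) : 0 <= B ->
  0 <= mean_square_cst (Omega := Omega) B H.
Proof.
move=> B0; apply: addr_ge0; apply: mulr_ge0 => //; first exact: sqr_ge0.
apply: addr_ge0; first exact: sqr_ge0.
apply: mulr_ge0; last exact: sqr_ge0.
by apply: mulr_ge0 => //; apply: addr_ge0 => //; exact: expR_ge0.
Qed.

(** With [D = b - a]: if [e ^ 2 D >= 1], then [D >= 1] because [e <= 1], and
    [2 e |Z| <= e ^ 2 + Z ^ 2] converts the mean square bound; otherwise the
    exponent is at most [1 / 4] and the exponential term exceeds the trivial
    bound. *)
Lemma empirical_mean_abs (R : realType) (Omega : finType) d (T : measurableType d)
    (P : probability T R) (F : R -> set (set T)) (Y : R -> T -> Omega) (a b : R)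
    (q : T -> Omega -> Omega -> R) (B H e : R) (h : T -> Omega -> R) (p : T -> R)
    (x : Omega) :
  filtration F -> adapted F Y -> right_cont_paths Y -> 0 <= a -> a < b ->
  markov_on P F Y a b q ->
  (forall w y z, `|q w y z| <= B) -> (forall w y, `|h w y| <= H) ->
  (forall y z, bounded_wrt (F a) (fun w => q w y z)) ->
  (forall y, bounded_wrt (F a) (fun w => h w y)) -> bounded_wrt (F a) p ->
  (forall w y, \sum_z q w y z * h w z = (y == x)%:R - p w) ->
  (forall w, 0 <= p w <= 1) -> 0 <= e <= 1 ->
  mean P (fun w => `|empirical Y a b w x - p w|) <=
    (1 + mean_square_cst (Omega := Omega) B H) * e +
    2 * expR (- (e ^+ 2 / (4 * #|Omega|%:R ^+ 2 * 1 * (b - a)^-1))).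
Proof.
move=> F_filt Y_adapt Y_rc a0 ab Ymk qB hH qF hF pF ph p01 /andP[e0 e1].
have [F_sigma F_meas F_incr] := F_filt.
have ba : 0 < b - a by rewrite subr_gt0.
have mY t y : 0 <= t -> measurable [set w | Y t w = y].
  by move=> t0; apply: (F_meas t t0); exact: Y_adapt.
set Z := fun w => empirical Y a b w x - p w.
have bp : bounded_mfun p by apply: bounded_wrt_mfun pF; [exact: F_sigma|exact: F_meas].
have emp01 w : 0 <= empirical Y a b w x <= 1.
  have [em0 em1] := empirical_prob_vector Y_rc a0 ab w.
  by rewrite em0 -em1 (bigD1 x) //= lerDl sumr_ge0.
have Z1 w : `|Z w| <= 1 by rewrite ler_norml /Z; have := emp01 w; have := p01 w; lra.
have bZ : bounded_mfun Z.
  apply: bounded_mfunB => //; split; first exact: measurable_empirical.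
  by exists 1 => w; rewrite ger0_norm; have /andP[] := emp01 w.
have bZn : bounded_mfun (fun w => `|Z w|) by exact: bounded_mfun_norm.
have C0 : 0 <= mean_square_cst (Omega := Omega) B H.
  by apply: mean_square_cst_ge0; exact: le_trans (qB point x x).
set C := mean_square_cst _ _ in C0 *.
have [eba|eba] := leP 1 (e ^+ 2 * (b - a)).
  have e_gt0 : 0 < e.
    rewrite lt_neqAle e0 andbT; apply/eqP => e_eq0; move: eba.
    by rewrite -e_eq0 expr0n mul0r ler10.
  have ab1 : 1 <= b - a.
    by apply: le_trans eba _; rewrite ler_piMl ?(ltW ba) // exprn_ile1.
  have ms := empirical_mean_square F_filt Y_adapt Y_rc a0 ab1 Ymk qB hH qF hF pF ph.
  have : mean P (fun w => 2 * e * `|Z w|) <= mean P (fun w => e ^+ 2 + Z w ^+ 2).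
    apply: le_mean => [||w].
    - by apply: bounded_mfunM => //; exact: bounded_mfun_cst.
    - by apply: bounded_mfunD; [exact: bounded_mfun_cst|exact: bounded_mfunX].
    - rewrite -[X in _ <= _ + X]real_normK ?num_real //.
      by have := sqr_ge0 (e - `|Z w|); nra.
  rewrite meanZ // meanD; [|exact: bounded_mfun_cst|exact: bounded_mfunX].
  rewrite mean_cst => bnd.
  have Ce : C / (b - a) <= C * e ^+ 2.
    by rewrite ler_wpM2l // -[X in X <= _]mul1r ler_pdivrMr.
  have {bnd} : 2 * e * mean P (fun w => `|Z w|) <= e * ((1 + C) * e).
    apply: le_trans bnd _; apply: (@le_trans _ _ (e ^+ 2 + C * e ^+ 2)).
      by rewrite lerD2l; exact: le_trans ms Ce.
    by rewrite le_eqVlt; apply/orP; left; apply/eqP; ring.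
  rewrite mulrAC mulrC ler_pM2l // => bnd.
  have M0 : 0 <= mean P (fun w => `|Z w|).
    rewrite -[X in X <= _](mean_cst P 0); apply: le_mean => //; exact: bounded_mfun_cst.
  by apply: ler_wpDr; [rewrite mulr_ge0 // expR_ge0|lra].
apply: (@le_trans _ _ 1).
  rewrite -(mean_cst P 1); apply: le_mean => //; exact: bounded_mfun_cst.
apply: ler_wpDl; first by rewrite mulr_ge0 // addr_ge0.
set y := e ^+ 2 / _; have y4 : y <= 4^-1.
  have m1 : 1 <= #|Omega|%:R ^+ 2 :> R.
    by rewrite exprn_ege1 // ler1n; apply/card_gt0P; exists x.
  rewrite /y mulr1 invfM invrK mulrA [_ / (4 * _) * _]mulrAC ler_pdivrMr; last first.
    by rewrite mulr_gt0 // (lt_le_trans _ m1).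
  by rewrite mulrA mulVf // mul1r (le_trans (ltW eba)).
have := expR_ge1Dx (- y); lra.
Qed.

(** By monotone convergence the sum of the series has finite expectation. *)
Lemma ae_bounded_partial_sums (R : realType) d (T : measurableType d)
    (P : probability T R) (X : nat -> T -> R) (M : R) :
  (forall n, bounded_mfun (X n)) -> (forall n w, 0 <= X n w) ->
  (forall n, \sum_(i < n) mean P (X i) <= M) ->
  {ae P, forall w, exists B, forall n, \sum_(i < n) X i w <= B}.
Proof.
move=> bX X0 XM.
pose f w := (\sum_(0 <= i <oo) (X i w)%:E)%E.
have mX n : measurable_fun setT (fun w => (X n w)%:E).
  by apply/measurable_EFinP; exact: (bX n).1.
have intf : P.-integrable setT f.
  apply/integrableP; split.
    by apply: ge0_emeasurable_sum => // n w _ _; rewrite lee_fin.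
  under eq_integral => w _.
    rewrite gee0_abs; last by apply: nneseries_ge0 => n _ _; rewrite lee_fin.
    over.
  rewrite integral_nneseries //; last by move=> n w _; rewrite lee_fin.
  apply: (@le_lt_trans _ _ M%:E); last exact: ltry.
  apply: lime_le.
    by apply: is_cvg_nneseries => n _ _; apply: integral_ge0 => w _; rewrite lee_fin.
  apply: nearW => n; rewrite big_mkord.
  have E i : (\int[P]_w (X i w)%:E = (mean P (X i))%:E)%E.
    rewrite /mean /Rintegral fineK //.
    exact: integrable_fin_num (bounded_mfun_integrable P (bX i)).
  by under eq_bigr do rewrite E; rewrite sumEFin lee_fin.
have := integrable_ae measurableT intf; apply: filterS => w /(_ I) fw.
exists (fine (f w)) => n; rewrite -lee_fin fineK // -sumEFin.
rewrite -(big_mkord xpredT (fun i => (X i w)%:E)).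
by apply: nneseries_lim_ge => i _ _; rewrite lee_fin.
Qed.

Lemma finite_nneseries_bounded (R : realType) (u : nat -> R) :
  (forall n, (0 < n)%N -> 0 <= u n) ->
  (\sum_(1 <= n <oo) (u n)%:E < +oo)%E ->
  exists M, forall n, \sum_(i < n) u i.+1 <= M.
Proof.
move=> u0 fin; set S := (\sum_(1 <= n <oo) (u n)%:E)%E in fin *.
have S0 : (0 <= S)%E by apply: nneseries_ge0 => n n1 _; rewrite lee_fin u0.
exists (fine S) => n; rewrite -lee_fin fineK ?ge0_fin_numE // -sumEFin.
rewrite -(big_mkord xpredT (fun i => (u i.+1)%:E)).
rewrite -(big_add1 _ _ 0 n.+1 xpredT (fun i => (u i)%:E)).
by apply: nneseries_lim_ge => i i1 _; rewrite lee_fin u0.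
Qed.

Lemma infinite_nneseries_unbounded (R : realType) (u : nat -> R) :
  (forall n, (0 < n)%N -> 0 <= u n) ->
  (\sum_(1 <= n <oo) (u n)%:E = +oo)%E ->
  forall M, exists n, M < \sum_(i < n) u i.+1.
Proof.
move=> u0 inf M; apply: contrapT => /forallNP bnd.
have {}bnd n : \sum_(i < n) u i.+1 <= M by rewrite leNgt; exact/negP.
suff : (\sum_(1 <= n <oo) (u n)%:E <= M%:E)%E by rewrite inf.
apply: lime_le; first by apply: is_cvg_nneseries => n n1 _; rewrite lee_fin u0.
apply: nearW => -[|n]; first by rewrite big_geq // lee_fin; have := bnd 0%N; rewrite big_ord0.
by rewrite big_add1 /= big_mkord sumEFin lee_fin.
Qed.

(** * Convergence of the online algorithm *)

Theorem theorem1 (R : realType) (Omega : finType) (d : nat) (d_gt0 : (0 < d)%N)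
  (* the optimization problem *)
  (Rmin Rmax : 'rV[R]_d)
  (Q : 'rV[R]_d -> Omega -> Omega -> R) (pi : 'rV[R]_d -> Omega -> R)
  (Q_gen : forall r, box Rmin Rmax r -> generator (Q r))
  (Q_irr : forall r, box Rmin Rmax r -> irreducible_chain (Q r))
  (Q_cont : forall x y, {within box Rmin Rmax, continuous (fun r => Q r x y)})
  (pi_stat : forall r, box Rmin Rmax r -> stationary (Q r) (pi r))
  (pi_rev : forall r, box Rmin Rmax r -> reversible (Q r) (pi r))
  (u : 'rV[R]_d -> R) (ropt : 'rV[R]_d)
  (u_conv : @convex_function R 'rV[R]_d (box Rmin Rmax) u)
  (u_opt : unique_minimizer (box Rmin Rmax) u ropt)
  (g : (Omega -> R) -> 'rV[R]_d -> 'rV[R]_d)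
  (u_grad : forall r, box Rmin Rmax r ->
     gradient_within (box Rmin Rmax) u r (g (pi r) r))
  (* times, step sizes and errors (indices n >= 1 for a and e) *)
  (tau a e : nat -> R)
  (tau0 : tau 0%N = 0) (tau_incr : forall n, tau n < tau n.+1)
  (a_gt0 : forall n, (0 < n)%N -> 0 < a n)
  (e_01 : forall n, (0 < n)%N -> 0 <= e n <= 1)
  (* the online algorithm *)
  (dT : measure_display) (T : measurableType dT) (P : probability T R)
  (F : R -> set (set T)) (F_filt : filtration F)
  (Y : R -> T -> Omega) (Y_rc : right_cont_paths Y) (Y_adapt : adapted F Y)
  (Rn : nat -> T -> 'rV[R]_d)
  (Rn_adapt : forall n i (B : set R), measurable B ->
     F (tau n) [set w | B (Rn n w 0 i)])
  (R0_box : forall w, box Rmin Rmax (Rn 0%N w))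
  (Y_markov : forall n,
     markov_on P F Y (tau n) (tau n.+1) (fun w => Q (Rn n w)))
  (Rn_rec : forall n w,
     Rn n.+1 w = truncate Rmin Rmax
       (Rn n w - a n.+1 *: g (empirical Y (tau n) (tau n.+1) w) (Rn n w)))
  (* conditions on step sizes, errors and observation frequencies *)
  (sum_a : (\sum_(1 <= n <oo) (a n)%:E = +oo)%E)
  (sum_a2 : (\sum_(1 <= n <oo) (a n ^+ 2)%:E < +oo)%E)
  (sum_ae : (\sum_(1 <= n <oo) (a n * e n)%:E < +oo)%E)
  (sum_exp : forall kappa : R, 0 < kappa ->
     (\sum_(1 <= n <oo)
        (a n * expR (- (e n ^+ 2 /
           (4 * #|Omega|%:R ^+ 2 * kappa * obs_freq tau n))))%:E < +oo)%E)
  (* regularity of the gradient map *)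
  (cg cl : R) (cg_ge0 : 0 <= cg) (cl_ge0 : 0 <= cl)
  (g_lip : forall mu nu r, prob_vector mu -> prob_vector nu ->
     box Rmin Rmax r ->
     forall i, `|g mu r 0 i - g nu r 0 i| <= cl * var_dist mu nu)
  (g_bnd : forall mu r, prob_vector mu -> box Rmin Rmax r ->
     norm2 (g mu r) <= cg) :
  {ae P, forall w, Rn n w @[n --> \oo] --> ropt}.
Proof.
have [F_sigma F_meas F_incr] := F_filt.
have tau_ge0 n : 0 <= tau n.
  by elim: n => [|n IH]; rewrite ?tau0 // (le_trans IH) // ltW.
have lohi i : Rmin 0 i <= Rmax 0 i.
  by have [/(_ i) /andP[h1 h2] _ _] := u_opt; exact: le_trans h2.
have Rn_box n w : box Rmin Rmax (Rn n w).
  by case: n => // n; rewrite Rn_rec; exact: truncate_box.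
have emp_prob n w : prob_vector (empirical Y (tau n) (tau n.+1) w).
  exact: empirical_prob_vector.
have box_cpt : compact (box Rmin Rmax) by exact: box_compact.
have poisson_cont := poisson_continuous Q_gen Q_irr pi_stat Q_cont.
have [B B0 QB] := @compact_within_bounded R (Omega * Omega)%type _ _
  (fun r xy => Q r xy.1 xy.2) box_cpt (fun xy => Q_cont xy.1 xy.2).
have [H H0 hH] := @compact_within_bounded R (Omega * Omega)%type _ _
  (fun r xy => poisson (Q r) xy.1 xy.2) box_cpt (fun xy => poisson_cont xy.1 xy.2).
(* Quantities that depend continuously on the parameter are known at the start
   of the interval in which the parameter is used. *)
have adaptedR n (phi : 'rV[R]_d -> R) : {within box Rmin Rmax, continuous phi} ->
    (exists c, forall r, box Rmin Rmax r -> `|phi r| <= c) ->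
    bounded_wrt (F (tau n)) (fun w => phi (Rn n w)).
  move=> cphi [c phic]; split; last by exists c => w; exact: phic.
  apply: (@measurable_within_box _ _ _ _ Rmin Rmax) => // i _ X mX.
  by rewrite setTI measurable_g_sigma; [exact: Rn_adapt|exact: F_sigma].
have adQ n x y : bounded_wrt (F (tau n)) (fun w => Q (Rn n w) x y).
  by apply: (adaptedR n (fun r => Q r x y)) => //; exists B => r rb; exact: (QB r rb (x, y)).
have adh n x y : bounded_wrt (F (tau n)) (fun w => poisson (Q (Rn n w)) x y).
  apply: (adaptedR n (fun r => poisson (Q r) x y)) => //.
  by exists H => r rb; exact: (hH r rb (x, y)).
have psys n w x := poisson_eq (Q_gen _ (Rn_box n w)) (Q_irr _ (Rn_box n w))
  (pi_stat _ (Rn_box n w)) x.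
have adpi n x : bounded_wrt (F (tau n)) (fun w => pi (Rn n w) x).
  under eq_fun => w do rewrite (psys n w x).1.
  by apply: bounded_mfun_sum => z; exact: adh.
have pi01 n w x : 0 <= pi (Rn n w) x <= 1.
  have [[p0 p1] _] := pi_stat _ (Rn_box n w).
  by rewrite p0 -p1 (bigD1 x) //= lerDl sumr_ge0.
pose dev n w x := `|empirical Y (tau n) (tau n.+1) w x - pi (Rn n w) x|.
pose z n w := cl * var_dist (empirical Y (tau n) (tau n.+1) w) (pi (Rn n w)).
pose C := mean_square_cst (Omega := Omega) B H.
pose rate n := expR (- (e n ^+ 2 / (4 * #|Omega|%:R ^+ 2 * 1 * obs_freq tau n))).
have mean_dev n x : mean P (fun w => dev n w x) <= (1 + C) * e n.+1 + 2 * rate n.+1.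
  apply: (empirical_mean_abs F_filt Y_adapt Y_rc (tau_ge0 n) (tau_incr n) (Y_markov n)
    (h := fun w y => poisson (Q (Rn n w)) y x)) => //.
  - by move=> w y y'; exact: (QB _ (Rn_box n w) (y, y')).
  - by move=> w y; exact: (hH _ (Rn_box n w) (y, x)).
  - by move=> w y; exact: (psys n w x).2.
  - exact: e_01.
have bdev n x : bounded_mfun (fun w => dev n w x).
  apply: bounded_mfun_norm; apply: bounded_mfunB.
    split; first by apply: measurable_empirical => // t y t0; apply: (F_meas t t0); exact: Y_adapt.
    exists 1 => w; have [em0 em1] := emp_prob n w.
    by rewrite ger0_norm // -em1 (bigD1 x) //= lerDl sumr_ge0.
  by apply: bounded_wrt_mfun (adpi n x); [exact: F_sigma|exact: F_meas].
have bsum n : bounded_mfun (fun w => \sum_x dev n w x).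
  by apply: bounded_mfun_sum => x; exact: bdev.
have bz n : bounded_mfun (z n).
  by do 2 (apply: bounded_mfunM; first exact: bounded_mfun_cst); exact: bsum.
have z0 n w : 0 <= z n w by rewrite mulr_ge0 // mulr_ge0 // sumr_ge0.
have mean_z n : mean P (z n) <= cl * (2^-1 * (#|Omega|%:R * ((1 + C) * e n.+1 + 2 * rate n.+1))).
  rewrite /z /var_dist meanZ; last first.
    by apply: bounded_mfunM; [exact: bounded_mfun_cst|exact: bsum].
  rewrite ler_wpM2l // meanZ; last exact: bsum.
  rewrite ler_wpM2l // mean_sum => [|x]; last exact: bdev.
  rewrite mulr_natl -sumr_const; apply: ler_sum => x _; exact: mean_dev.
have [Ma2 a2P] := finite_nneseries_bounded (fun n _ => sqr_ge0 (a n)) sum_a2.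
have [Mae aeP] : exists M, forall n, \sum_(i < n) a i.+1 * e i.+1 <= M.
  apply: (finite_nneseries_bounded (u := fun n => a n * e n)) => // n n0.
  by apply: mulr_ge0; [exact: ltW (a_gt0 _ n0)|have /andP[] := e_01 n n0].
have [Mr rP] : exists M, forall n, \sum_(i < n) a i.+1 * rate i.+1 <= M.
  apply: (finite_nneseries_bounded (u := fun n => a n * rate n)) => [n n0|].
    by rewrite mulr_ge0 ?expR_ge0 // ltW // a_gt0.
  exact: sum_exp.
have a_div := infinite_nneseries_unbounded (fun n n0 => ltW (a_gt0 n n0)) sum_a.
have : {ae P, forall w, exists M, forall n, \sum_(i < n) a i.+1 * z i w <= M}.
  apply: (@ae_bounded_partial_sums _ _ _ _ (fun i w => a i.+1 * z i w)
    (cl * (2^-1 * (#|Omega|%:R * ((1 + C) * Mae + 2 * Mr))))).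
  - by move=> n; apply: bounded_mfunM => //; exact: bounded_mfun_cst.
  - by move=> n w; rewrite mulr_ge0 // ltW // a_gt0.
  - move=> n.
    pose c := cl * (2^-1 * #|Omega|%:R) : R.
    have c0 : 0 <= c by rewrite mulr_ge0 // mulr_ge0.
    have C0 : 0 <= 1 + C by apply: addr_ge0 => //; exact: mean_square_cst_ge0.
    apply: (@le_trans _ _ (\sum_(i < n)
        (c * (1 + C) * (a i.+1 * e i.+1) + c * 2 * (a i.+1 * rate i.+1)))).
      apply: ler_sum => i _; rewrite meanZ //.
      apply: le_trans (ler_wpM2l (ltW (a_gt0 i.+1 isT)) (mean_z i)) _.
      by rewrite le_eqVlt; apply/orP; left; apply/eqP; rewrite /c; ring.
    rewrite big_split /= -!mulr_sumr.
    apply: (@le_trans _ _ (c * (1 + C) * Mae + c * 2 * Mr)).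
      by apply: lerD; apply: ler_wpM2l; [exact: mulr_ge0|exact: aeP|exact: mulr_ge0|exact: rP].
    by rewrite le_eqVlt; apply/orP; left; apply/eqP; rewrite /c; ring.
(* On the almost sure event the statement is deterministic. *)
apply: filterS => w [Mz zP].
apply: (@projected_gradient_cvg _ _ Rmin Rmax u ropt (fun r => g (pi r) r)
  (fun n => Rn n w) (fun n => g (empirical Y (tau n) (tau n.+1) w) (Rn n w))
  (fun n => a n.+1) (fun n => z n w) cg Ma2 Mz) => //.
- by move=> n; exact: a_gt0.
- by move=> n; exact: g_bnd.
- move=> n i; apply: g_lip => //.
  by have [] := pi_stat _ (Rn_box n w).
Qed.
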